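(* Let $\mathcal{H}\subset\mathbb{M}_{M,N}$ be a linear subspace, let $F\in\mathcal{H}$ and let $\tau>0$. Given any starting point $W^1\in\mathbb{M}_{M,N}$, the Picard iteration $W^{n+1}=\mathfrak{B}_{F,\tau,2}(W^n)$ converges to a fixed point $W^{\circ}$ of $\mathfrak{B}_{F,\tau,2}$. Moreover, the orthogonal projection $\mathcal{P}_{\mathcal{H}}(W^{\circ})$ is unique (i.e. it is the same for all fixed points), and $$A^{\circ}=2F-\mathcal{P}_{\mathcal{H}}(W^{\circ})$$ is the unique solution of $$\operatorname*{arg\,min}_{A\in\mathcal{H}}\ \mathcal{R}_{\tau}(A)+2\|A-F\|^2 .$$ Moreover, $W^{\circ}$ has the property that $A^{\circ}$ also solves the problem, over all matrices, $$\operatorname*{arg\,min}_{A\in\mathbb{M}_{M,N}}\ \mathcal{R}_{\tau}(A)+\|A-W^{\circ}\|^2,$$ and if $W^{\circ}$ has no singular value equal to $\tau$, then $A^{\circ}$ is the solution to the non-convex problem $$\operatorname*{arg\,min}_{A\in\mathcal{H}}\ \sigma_0^2\,\mathrm{rank}(A)+\|A-F\|^2\qquad\text{with }\sigma_0=\tau/\sqrt{2}.$$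
   Context: $\mathbb{M}_{M,N}$ is the Euclidean space of $M\times N$ matrices (real or complex) with the Frobenius norm $\|\cdot\|$; $\sigma_j(A)$ denotes the singular values of $A$. For $\sigma_0>0$, $$\mathcal{R}_{\sigma_0}(A)=\sum_j\left(\sigma_0^2-\big(\max(\sigma_0-\sigma_j(A),0)\big)^2\right).$$ $\mathcal{P}_{\mathcal{H}}$ and $\mathcal{P}_{\mathcal{H}^\perp}$ are the orthogonal projections onto $\mathcal{H}$ and its orthogonal complement. Singular value functional calculus: for a real-valued $f$ on $[0,\infty)$ with $f(0)=0$ and $A=U\,\mathrm{diag}(\{\sigma_j(A)\})V^*$ a singular value decomposition, $\mathfrak{S}_f(A)=U\,\mathrm{diag}(\{f(\sigma_j(A))\})V^*$. For $\tau>0$ and $1<q<\infty$ set $s_{\tau,q}(\sigma)=\max\left(\min(\sigma,\tau),\frac{\sigma}{q}\right)$ and $$\mathfrak{B}_{F,\tau,q}(W)=\mathfrak{S}_{s_{\tau,q}}\big(qF+\mathcal{P}_{\mathcal{H}^\perp}(W)\big),\qquad W\in\mathbb{M}_{M,N}.$$ *)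

(* Defs.v *)
From mathcomp Require Import all_boot all_order all_algebra.
From mathcomp Require Import complex.
From mathcomp Require Import boolp classical_sets functions reals topology normedtype.

Set Implicit Arguments.
Unset Strict Implicit.
Unset Printing Implicit Defensive.

Import Order.TTheory GRing.Theory Num.Theory.
Import numFieldNormedType.Exports.

Local Open Scope classical_set_scope.
Local Open Scope ring_scope.

(* The scalars are either R or R[i]; matrices of either kind are treated at
   once by quantifying over [scalar_kind]. *)
Variant scalar_kind := RealScalars | ComplexScalars.

Definition scalar_field (R : realType) (k : scalar_kind) : numFieldType :=
  match k with
  | RealScalars => R
  | ComplexScalars => R[i]
  end.

Definition sconj {R : realType} {k : scalar_kind} :
    scalar_field R k -> scalar_field R k :=
  match k return scalar_field R k -> scalar_field R k with
  | RealScalars => fun x : R => x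
  | ComplexScalars => fun z : R[i] => conjc z
  end.

Definition sRe {R : realType} {k : scalar_kind} : scalar_field R k -> R :=
  match k return scalar_field R k -> R with
  | RealScalars => fun x : R => x
  | ComplexScalars => fun z : R[i] => complex.Re z
  end.

Definition of_real {R : realType} (k : scalar_kind) : R -> scalar_field R k :=
  match k return R -> scalar_field R k with
  | RealScalars => fun x : R => x
  | ComplexScalars => fun x : R => x%:C%C
  end.

Section Matrices.
Variables (R : realType) (k : scalar_kind).
Local Notation K := (scalar_field R k).

Definition adjmx (m n : nat) (A : 'M[K]_(m, n)) : 'M[K]_(n, m) :=
  map_mx sconj A^T.

Definition unitary_mx (n : nat) (U : 'M[K]_n) : Prop :=
  U *m adjmx U = 1%:M.

Section Rectangular.
Variables (M N : nat).
Local Notation MMN := 'M[K]_(M, N).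

Definition frob_dot (A B : MMN) : K := \tr (A *m adjmx B).

Definition frob_norm (A : MMN) : R := Num.sqrt (sRe (frob_dot A A)).

Definition orth_compl (S : set MMN) : set MMN :=
  [set Z | forall X, S X -> frob_dot Z X = 0].

(* For a linear subspace S exactly one matrix P qualifies. *)
Definition orth_proj (S : set MMN) (W : MMN) : MMN :=
  xget 0 [set P | S P /\ orth_compl S (W - P)].

Definition rect_diag (s : nat -> R) : MMN :=
  \matrix_(i, j) (if i == j :> nat then of_real k (s i) else 0).

(* The singular values s 0 >= s 1 >= ... are extended by zero from index
   minn M N on, so that the sequence s is determined by A. *)
Definition is_svd (A : MMN) (U : 'M[K]_M) (s : nat -> R) (V : 'M[K]_N) : Prop :=
  [/\ unitary_mx U, unitary_mx V,
      [/\ forall j, 0 <= s j,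
          forall i j, (i <= j)%N -> s j <= s i &
          forall j, (minn M N <= j)%N -> s j = 0] &
      A = U *m rect_diag s *m adjmx V].

Definition singular_values (A : MMN) : nat -> R :=
  xget (fun=> 0) [set s | exists U V, is_svd A U s V].

(* For f 0 = 0 the result does not depend on the decomposition. *)
Definition sv_calculus (f : R -> R) (A : MMN) : MMN :=
  xget 0 [set B | exists U s V,
    is_svd A U s V /\ B = U *m rect_diag (f \o s) *m adjmx V].

Definition R_pen (sigma0 : R) (A : MMN) : R :=
  \sum_(j < minn M N)
    (sigma0 ^+ 2 - (Num.max (sigma0 - singular_values A j) 0) ^+ 2).

Definition s_fun (tau q sigma : R) : R :=
  Num.max (Num.min sigma tau) (sigma / q).

Definition B_op (H : {vspace MMN}) (F : MMN) (tau q : R) (W : MMN) : MMN :=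
  sv_calculus (s_fun tau q)
    (of_real k q *: F + orth_proj (orth_compl [set` H]) W).

Definition argmin (S : set MMN) (J : MMN -> R) : set MMN :=
  [set A | S A /\ forall B, S B -> J A <= J B].

End Rectangular.
End Matrices.

(* Main.v *)
Require Import Defs.
From HB Require Import structures.
From mathcomp Require Import all_boot all_order all_algebra.
From mathcomp Require Import complex ring lra zify perm.
From mathcomp Require Import boolp classical_sets functions reals topology.
From mathcomp Require Import normedtype sequences realfun.

Set Implicit Arguments.
Unset Strict Implicit.
Unset Printing Implicit Defensive.

Import Order.TTheory GRing.Theory Num.Theory.
Import numFieldNormedType.Exports.

Local Open Scope classical_set_scope.
Local Open Scope ring_scope.

(** Write [s] for [s_fun tau 2], [P] for the orthogonal projection onto [H],
    [T] for [B_op H F tau 2] and [S] for [sv_calculus s].  Both [s] and its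
    residual [x - s x] are nondecreasing on the half-line, and [s y] is half a
    slope at [y - s y] of the convex function [penalty tau x + x ^+ 2].  Von
    Neumann's trace inequality ([von_neumann_trace]) carries these two scalar
    facts over to matrices: the first makes [S] firmly nonexpansive
    ([sv_calculus_firm]), and the second says that [W = S Y] is half a
    subgradient of [R_pen tau A + rdot A A] at [A = Y - W]
    ([prox_subgradient]).

    Convergence.  [T] is [S] after an affine orthogonal projection, hence an
    averaged map ([B_op_averaged]), and its orbits are bounded because [s]
    halves large singular values ([B_op_iter_bounded]).  Let [L] be a limit of
    a subsequence of an orbit.  The lengths of the steps of the orbit decrease
    to a limit, so the orbit of [L] moves at constant speed; for an averaged map
    this means constant velocity, and boundedness leaves only the velocity zero.
    So [L] is a fixed point; the distance to it decreases along the original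
    orbit, which therefore converges to [L] ([picard_averaged]).  This also
    proves that a fixed point exists.

    Optimality.  At a fixed point [Wo] put [Y = 2 *: F + (Wo - P Wo)]; then
    [Wo = S Y], and [Ao = Y - Wo] is [2 *: F - P Wo].  The subgradient inequality
    at [Ao] is exactly the claim on all matrices.  Adding the strongly convex
    [rdot A A] and using that [Wo - P Wo] is orthogonal to [H] gives, for [B] in
    [H], that the first objective at [B] exceeds its value at [Ao] by at
    least [rdot (B - Ao) (B - Ao)] ([fixed_point_gap]).  Hence [Ao] is the only
    minimiser, and [P Wo] does not depend on [Wo].  Finally
    [R_pen tau A <= tau ^+ 2 * \rank A], with equality when every singular value
    of [A] is zero or at least [tau]; this is the case for [Ao] when [tau] is not
    a singular value of [Wo], and the gap then passes to the rank objective.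

    Singular value decompositions are produced for both kinds of scalars by one
    variational argument ([svd_exists]), and the trace inequality also shows that
    the singular values do not depend on the decomposition
    ([svd_values_unique]). *)

(** * Real and complex scalars *)

Section ScalarField.
Variables (R : realType) (k : scalar_kind).
Local Notation K := (scalar_field R k).
Implicit Types x y : K.

Fact sconj_is_additive : additive (@sconj R k).
Proof. by case: (k) => // x y; rewrite /= rmorphB. Qed.

Fact sconj_is_multiplicative : multiplicative (@sconj R k).
Proof. by case: (k) => //=; split=> [x y|]; rewrite ?rmorphM ?rmorph1. Qed.

HB.instance Definition _ :=
  GRing.isAdditive.Build K K (@sconj R k) sconj_is_additive.
HB.instance Definition _ :=
  GRing.isMultiplicative.Build K K (@sconj R k) sconj_is_multiplicative.

Fact sRe_is_additive : additive (@sRe R k).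
Proof. by case: (k) => // -[a b] [c d]. Qed.

HB.instance Definition _ :=
  GRing.isAdditive.Build K R (@sRe R k) sRe_is_additive.

Fact of_real_is_additive : additive (of_real k : R -> K).
Proof. by case: (k) => // x y; rewrite /= rmorphB. Qed.

Fact of_real_is_multiplicative : multiplicative (of_real k : R -> K).
Proof. by case: (k) => //=; split=> [x y|]; rewrite ?rmorphM ?rmorph1. Qed.

HB.instance Definition _ :=
  GRing.isAdditive.Build R K (of_real k) of_real_is_additive.
HB.instance Definition _ :=
  GRing.isMultiplicative.Build R K (of_real k) of_real_is_multiplicative.

Lemma sconjK : involutive (@sconj R k).
Proof. by case: (k) => //= x; rewrite conjcK. Qed.

Lemma sconj_of_real (a : R) : sconj (of_real k a) = of_real k a.
Proof. by case: (k) => //=; rewrite oppr0. Qed.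

Lemma sRe_of_real (a : R) : sRe (of_real k a) = a.
Proof. by case: (k). Qed.

Lemma sReZ (a : R) x : sRe (of_real k a * x) = a * sRe x.
Proof. by case: (k) x => //= -[c d] /=; rewrite mul0r subr0. Qed.

Lemma sRe_conj x : sRe (sconj x) = sRe x.
Proof. by case: (k) x => //= -[]. Qed.

Lemma sconj_fixed x : sconj x = x -> x = of_real k (sRe x).
Proof.
case: (k) x => //= -[a b] /= [] bE; congr Complex.
by apply/eqP; rewrite -[_ == _](mulrn_eq0 b 2) mulr2n -{1}bE addNr.
Qed.

Definition sqmod x : R := sRe (x * sconj x).

Lemma mul_sconj x : x * sconj x = of_real k (sqmod x).
Proof. by apply: sconj_fixed; rewrite rmorphM /= sconjK mulrC. Qed.

Lemma sqmod_ge0 x : 0 <= sqmod x.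
Proof.
rewrite /sqmod; case: (k) x => /= [x|[a b] /=]; first by rewrite -expr2 sqr_ge0.
by rewrite mulrN opprK addr_ge0 // -expr2 sqr_ge0.
Qed.

Lemma sqmod_conj x : sqmod (sconj x) = sqmod x.
Proof. by rewrite /sqmod sconjK mulrC. Qed.

Lemma sqmod_eq0 x : sqmod x = 0 -> x = 0.
Proof.
rewrite /sqmod; case: (k) x => /= [x /eqP|[a b] /=].
  by rewrite mulf_eq0 orbb => /eqP.
move=> /eqP; rewrite mulrN opprK -!expr2 paddr_eq0 ?sqr_ge0 // !sqrf_eq0.
by move=> /andP[/eqP -> /eqP ->].
Qed.

Lemma sqr_sRe_le x : sRe x ^+ 2 <= sqmod x.
Proof.
rewrite /sqmod; case: (k) x => /= [x|[a b] /=]; first by rewrite expr2.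
by rewrite mulrN opprK -!expr2 lerDl sqr_ge0.
Qed.

Lemma sRe_mul_le x y : sRe (x * y) <= (sqmod x + sqmod y) / 2.
Proof.
have := sqmod_ge0 (x - sconj y); rewrite -(sqmod_conj y) /sqmod rmorphB /= sconjK.
have -> : (x - sconj y) * (sconj x - y)
    = x * sconj x + sconj y * y - (x * y + sconj (x * y)).
  by rewrite rmorphM; ring.
rewrite raddfB /= !raddfD /= sRe_conj; lra.
Qed.

(** Two real coordinates of a scalar, for both kinds at once: [iota] is the
    imaginary unit for complex scalars and 0 for real ones. *)
Lemma scalar_split : exists iota : K, forall x,
  x = of_real k (sRe x) + iota * of_real k (sRe (- iota * x)) /\
  sqmod (- iota * x) <= sqmod x.
Proof.
rewrite /sqmod; case: (k) => /=.
  by exists 0 => x; rewrite mul0r addr0 oppr0 !mul0r -expr2 sqr_ge0.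
exists 'i%C => -[a b]; simpc; split; first by congr Complex; ring.
by simpc; rewrite /=; lra.
Qed.

Lemma ltr_of_real (a b : R) : (of_real k a < of_real k b) = (a < b).
Proof. by case: (k) => //=; rewrite ltcR. Qed.

Lemma gt0_of_real x : 0 < x -> of_real k (sRe x) = x.
Proof. by case: (k) x => //= -[a b]; rewrite ltcE /= => /andP[/eqP ->]. Qed.

Lemma norm_sRe_le x : of_real k `|sRe x| <= `|x|.
Proof. by case: (k) x => //= x; exact: normc_ge_Re. Qed.

Lemma norm_of_real (a : R) : `|of_real k a| = of_real k `|a|.
Proof. by case: (k) => //=; rewrite normc_def /= expr0n addr0 sqrtr_sqr. Qed.

Lemma norm_sconj x : `|sconj x| = `|x|.
Proof. by case: (k) x => //= x; exact: normcJ. Qed.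

Lemma sRe_continuous : continuous (@sRe R k).
Proof.
move=> x; apply/(@cvgrPdist_lt _ _ _ (nbhs x)) => e e0; near=> t.
rewrite -raddfB -ltr_of_real (le_lt_trans (norm_sRe_le _)) //.
by near: t; apply: cvgr_dist_lt => //; rewrite -(rmorph0 (of_real k)) ltr_of_real.
Unshelve. all: by end_near. Qed.

Lemma of_real_continuous : continuous (of_real k : R -> K).
Proof.
move=> x; apply/(@cvgrPdist_lt _ _ _ (nbhs x)) => e e0; near=> t.
rewrite -rmorphB norm_of_real -(gt0_of_real e0) ltr_of_real.
near: t; apply: cvgr_dist_lt => //.
by rewrite -ltr_of_real gt0_of_real // rmorph0.
Unshelve. all: by end_near. Qed.

Lemma sconj_continuous : continuous (@sconj R k).
Proof.
move=> x; apply/(@cvgrPdist_lt _ _ _ (nbhs x)) => e e0; near=> t.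
by rewrite -rmorphB norm_sconj; near: t; exact: cvgr_dist_lt.
Unshelve. all: by end_near. Qed.

End ScalarField.

(** * Limits of matrices *)

(** The growth condition on [f] is all that limits need of a subsequence, and
    unlike strict monotonicity it is immediate for compositions. *)
Lemma cvg_cofinal (T : topologicalType) (u : nat -> T) (l : T) (f : nat -> nat) :
  (forall n, (n <= f n)%N) -> u @ \oo --> l -> u (f n) @[n --> \oo] --> l.
Proof.
move=> nf ul; apply: (@cvg_comp _ _ _ f u _ \oo) => // A [N _ NA].
by exists N => // n /= Nn; apply: NA; exact: leq_trans (nf n).
Qed.

(** The coordinates converge one after the other, along nested subsequences. *)
Lemma bolzano_weierstrass_family (R : realType) (T : eqType) (s : seq T)
    (u : nat -> T -> R) (C : R) :
  (forall n t, `|u n t| <= C) ->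
  exists2 f : nat -> nat, (forall n, (n <= f n)%N) &
    forall t, t \in s -> cvgn (fun n => u (f n) t).
Proof.
move=> uC; elim: s => [|t s [f nf uf]]; first by exists id.
have [|g gi ug] := @bolzano_weierstrass R (fun n => u (f n) t).
  by exists C; split=> [|x Cx n _]; [exact: num_real|exact/(le_trans (uC _ _))/ltW].
have ng n : (n <= g n)%N.
  elim: n => // n IH; apply: (leq_ltn_trans IH).
  have := leW_mono gi n n.+1; rewrite !ltEnat /= => ->; exact: ltnSn.
exists (f \o g) => [n|t']; first exact: leq_trans (nf _).
rewrite inE => /predU1P[->|/uf /cvg_ex[l ul]]; first exact: ug.
by apply/cvg_ex; exists l; exact: (cvg_cofinal ng ul).
Qed.

Section MatrixLimits.
Variables (R : realType) (k : scalar_kind).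
Local Notation K := (scalar_field R k).

Definition mx_cvg (m n : nat) (X : nat -> 'M[K]_(m, n)) (L : 'M[K]_(m, n)) :=
  forall i j, X l i j @[l --> \oo] --> L i j.

Lemma mx_cvg_unique (m n : nat) (X : nat -> 'M[K]_(m, n)) L L' :
  mx_cvg X L -> mx_cvg X L' -> L = L'.
Proof.
move=> XL XL'; apply/matrixP => i j.
by apply: (@norm_cvg_unique _ _ (X l i j @[l --> \oo])); [exact: XL|exact: XL'].
Qed.

Lemma mx_cvg_cst (m n : nat) (L : 'M[K]_(m, n)) : mx_cvg (fun=> L) L.
Proof. by move=> i j; exact: cvg_cst. Qed.

Lemma mx_cvgB (m n : nat) (X Y : nat -> 'M[K]_(m, n)) L L' :
  mx_cvg X L -> mx_cvg Y L' -> mx_cvg (fun l => X l - Y l) (L - L').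
Proof.
move=> XL YL i j; rewrite !mxE; under eq_fun do rewrite !mxE.
by apply: cvgB; [exact: XL|exact: YL].
Qed.

Lemma mx_cvgM (m n p : nat) (X : nat -> 'M[K]_(m, n)) (Y : nat -> 'M[K]_(n, p))
    L L' :
  mx_cvg X L -> mx_cvg Y L' -> mx_cvg (fun l => X l *m Y l) (L *m L').
Proof.
move=> XL YL i j; rewrite !mxE; under eq_fun do rewrite !mxE.
apply: cvg_big => [|h _]; first exact: add_continuous.
by apply: cvgM; [exact: XL|exact: YL].
Qed.

Lemma mx_cvg_adj (m n : nat) (X : nat -> 'M[K]_(m, n)) L :
  mx_cvg X L -> mx_cvg (fun l => adjmx (X l)) (adjmx L).
Proof.
move=> XL i j; rewrite !mxE; under eq_fun do rewrite !mxE.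
by apply: (continuous_cvg _ (@sconj_continuous R k _)); exact: XL.
Qed.

Lemma mx_cvg_sub (m n : nat) (X : nat -> 'M[K]_(m, n)) L (f : nat -> nat) :
  (forall l, (l <= f l)%N) -> mx_cvg X L -> mx_cvg (fun l => X (f l)) L.
Proof. by move=> lf XL i j; exact: (cvg_cofinal lf (XL i j)). Qed.

Lemma mx_bolzano_weierstrass (m n : nat) (X : nat -> 'M[K]_(m, n)) (C : R) :
  (forall l i j, sqmod (X l i j) <= C) ->
  exists2 f : nat -> nat, (forall l, (l <= f l)%N) &
    exists L, mx_cvg (fun l => X (f l)) L.
Proof.
move=> XC; have [iota split_iota] := scalar_split R k.
pose u l (t : bool * 'I_m * 'I_n) :=
  let x := X l t.1.2 t.2 in sRe (if t.1.1 then x else - iota * x).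
have uC l t : `|u l t| <= Num.sqrt C.
  rewrite -sqrtr_sqr ler_wsqrtr // (le_trans (sqr_sRe_le _)) //.
  case: t => -[[] i] j //=.
  exact: le_trans (split_iota _).2 _.
have [f lf uf] := bolzano_weierstrass_family (enum {: bool * 'I_m * 'I_n}) uC.
exists f => //.
exists (\matrix_(i, j) (of_real k (limn (fun l => u (f l) (true, i, j))) +
          iota * of_real k (limn (fun l => u (f l) (false, i, j))))) => i j.
rewrite mxE; under eq_fun => l do rewrite (split_iota (X (f l) i j)).1.
apply: cvgD; last apply: cvgMr; apply: (continuous_cvg _ (@of_real_continuous R k _)).
- exact: (uf (true, i, j) (mem_enum _ _)).
- exact: (uf (false, i, j) (mem_enum _ _)).
Qed.

End MatrixLimits.

(** * The real inner product of matrices *)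

Section InnerProduct.
Variables (R : realType) (k : scalar_kind).
Local Notation K := (scalar_field R k).

Lemma adjmxK (m n : nat) (A : 'M[K]_(m, n)) : adjmx (adjmx A) = A.
Proof. by apply/matrixP => i j; rewrite !mxE sconjK. Qed.

Lemma adjmxM (m n p : nat) (A : 'M[K]_(m, n)) (B : 'M[K]_(n, p)) :
  adjmx (A *m B) = adjmx B *m adjmx A.
Proof. by rewrite /adjmx trmx_mul map_mxM. Qed.

Lemma adjmx1 (n : nat) : adjmx 1%:M = 1%:M :> 'M[K]_n.
Proof. by rewrite /adjmx trmx1 map_mx1. Qed.

Lemma adjmxD (m n : nat) (A B : 'M[K]_(m, n)) :
  adjmx (A + B) = adjmx A + adjmx B.
Proof. by rewrite /adjmx linearD map_mxD. Qed.

Lemma adjmxN (m n : nat) (A : 'M[K]_(m, n)) : adjmx (- A) = - adjmx A.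
Proof. by rewrite /adjmx linearN map_mxN. Qed.

Lemma adjmxZ (m n : nat) (a : K) (A : 'M[K]_(m, n)) :
  adjmx (a *: A) = sconj a *: adjmx A.
Proof. by rewrite /adjmx linearZ map_mxZ. Qed.

Lemma adjmx_delta (m n : nat) (i : 'I_m) (j : 'I_n) :
  adjmx (delta_mx i j : 'M[K]_(m, n)) = delta_mx j i.
Proof. by rewrite /adjmx trmx_delta map_delta_mx. Qed.

Lemma sRe_tr_adj (n : nat) (A : 'M[K]_n) : sRe (\tr (adjmx A)) = sRe (\tr A).
Proof.
rewrite /adjmx -(mxtrace_tr A) /mxtrace !raddf_sum.
by apply: eq_bigr => i _; rewrite !mxE /= sRe_conj.
Qed.

Lemma unitaryV (n : nat) (U : 'M[K]_n) :
  unitary_mx U -> adjmx U *m U = 1%:M.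
Proof. exact: mulmx1C. Qed.

Lemma unitary1 (n : nat) : unitary_mx (1%:M : 'M[K]_n).
Proof. by rewrite /unitary_mx adjmx1 mulmx1. Qed.

Lemma unitary_adj (n : nat) (U : 'M[K]_n) :
  unitary_mx U -> unitary_mx (adjmx U).
Proof. by move=> uU; rewrite /unitary_mx adjmxK; exact: unitaryV. Qed.

Lemma unitaryM (n : nat) (U V : 'M[K]_n) :
  unitary_mx U -> unitary_mx V -> unitary_mx (U *m V).
Proof.
move=> uU uV; rewrite /unitary_mx adjmxM mulmxA -(mulmxA U) uV mulmx1.
exact: uU.
Qed.

Lemma unitary_row (n : nat) (U : 'M[K]_n) (i : 'I_n) :
  unitary_mx U -> \sum_j sqmod (U i j) = 1.
Proof.
move=> /matrixP /(_ i i); rewrite !mxE eqxx => /(congr1 (@sRe R k)).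
rewrite raddf_sum -(rmorph1 (of_real k)) sRe_of_real => <-.
by apply: eq_bigr => j _; rewrite !mxE.
Qed.

Lemma unitary_col (n : nat) (U : 'M[K]_n) (j : 'I_n) :
  unitary_mx U -> \sum_i sqmod (U i j) = 1.
Proof.
move=> /unitary_adj uU; rewrite -(unitary_row j uU).
by apply: eq_bigr => i _; rewrite !mxE sqmod_conj.
Qed.

Section Rectangular.
Variables (m n : nat).
Implicit Types A B C : 'M[K]_(m, n).

(** The real part makes complex matrices a real Euclidean space as well, whose
    norm is the Frobenius norm. *)
Definition rdot A B : R := sRe (frob_dot A B).

Lemma rdotC A B : rdot A B = rdot B A.
Proof. by rewrite /rdot /frob_dot -sRe_tr_adj adjmxM adjmxK. Qed.

Lemma rdotDl A B C : rdot (A + B) C = rdot A C + rdot B C.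
Proof. by rewrite /rdot /frob_dot mulmxDl linearD raddfD. Qed.

Lemma rdotNl A B : rdot (- A) B = - rdot A B.
Proof. by rewrite /rdot /frob_dot mulNmx linearN raddfN. Qed.

Lemma rdotZl (a : R) A B : rdot (of_real k a *: A) B = a * rdot A B.
Proof. by rewrite /rdot /frob_dot -scalemxAl linearZ sReZ. Qed.

Lemma rdotDr A B C : rdot C (A + B) = rdot C A + rdot C B.
Proof. by rewrite rdotC rdotDl !(rdotC C). Qed.

Lemma rdotNr A B : rdot B (- A) = - rdot B A.
Proof. by rewrite rdotC rdotNl rdotC. Qed.

Lemma rdotZr (a : R) A B : rdot B (of_real k a *: A) = a * rdot B A.
Proof. by rewrite rdotC rdotZl rdotC. Qed.

Lemma rdot0 A : rdot 0 A = 0.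
Proof. by rewrite -(subrr 0) rdotDl rdotNl subrr. Qed.

Definition rdotE := (rdotDl, rdotDr, rdotNl, rdotNr, rdotZl, rdotZr).

Lemma rdot_sqmod A : rdot A A = \sum_i \sum_j sqmod (A i j).
Proof.
rewrite /rdot /frob_dot /mxtrace raddf_sum; apply: eq_bigr => i _.
by rewrite mxE raddf_sum; apply: eq_bigr => j _; rewrite !mxE.
Qed.

Lemma rdot_ge0 A : 0 <= rdot A A.
Proof.
by rewrite rdot_sqmod; do 2![apply: sumr_ge0 => ? _]; exact: sqmod_ge0.
Qed.

Lemma rdot_eq0 A : rdot A A = 0 -> A = 0.
Proof.
rewrite rdot_sqmod => A0; apply/matrixP => i j; rewrite mxE.
have rge0 i' : 0 <= \sum_j' sqmod (A i' j').
  by apply: sumr_ge0 => ? _; exact: sqmod_ge0.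
have /eqP := A0; rewrite psumr_eq0 // => /allP /(_ i (mem_index_enum i)) /=.
rewrite psumr_eq0 => [/allP /(_ j (mem_index_enum j)) /eqP|? _].
  exact: sqmod_eq0.
exact: sqmod_ge0.
Qed.

Lemma sqr_frob_norm A : frob_norm A ^+ 2 = rdot A A.
Proof. by rewrite /frob_norm sqr_sqrtr //; exact: rdot_ge0. Qed.

Lemma sqmod_le_rdot A i j : sqmod (A i j) <= rdot A A.
Proof.
rewrite rdot_sqmod (bigD1 i) //= (bigD1 j) //= -addrA lerDl addr_ge0 //.
  by apply: sumr_ge0 => ? _; exact: sqmod_ge0.
by do 2![apply: sumr_ge0 => ? _]; exact: sqmod_ge0.
Qed.

Lemma rdot_unitary (U : 'M[K]_m) (V : 'M[K]_n) A B :
  unitary_mx U -> unitary_mx V ->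
  rdot (U *m A *m adjmx V) (U *m B *m adjmx V) = rdot A B.
Proof.
move=> uU uV; rewrite /rdot /frob_dot !adjmxM adjmxK !mulmxA.
rewrite -(mulmxA _ _ V) unitaryV // mulmx1 mxtrace_mulC !mulmxA.
by rewrite unitaryV // mul1mx.
Qed.

Lemma rdot_cvg (X Y : nat -> 'M[K]_(m, n)) A B :
  mx_cvg X A -> mx_cvg Y B -> rdot (X l) (Y l) @[l --> \oo] --> rdot A B.
Proof.
move=> XA YB; apply: (continuous_cvg _ (@sRe_continuous R k _)).
apply: cvg_big => [|i _]; first exact: add_continuous.
by apply: mx_cvgM => //; exact: mx_cvg_adj.
Qed.

End Rectangular.

Lemma unitary_cvg (n : nat) (X : nat -> 'M[K]_n) (U : 'M[K]_n) :
  (forall l, unitary_mx (X l)) -> mx_cvg X U -> unitary_mx U.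
Proof.
move=> uX XU; apply: (mx_cvg_unique (mx_cvgM XU (mx_cvg_adj XU))).
by under eq_fun do rewrite (uX _); exact: mx_cvg_cst.
Qed.

End InnerProduct.

(** * Von Neumann's trace inequality *)

Section Rearrangement.
Variable R : realFieldType.

(** The weight [c i] is [c n] plus the drops [c r - c r.+1] for [i <= r < n];
    exchanging the two sums groups the [z i] into partial sums. *)
Lemma abel_summation (n : nat) (c : nat -> R) (z : 'I_n -> R) :
  \sum_(i < n) c i * z i = c n * (\sum_i z i) +
    \sum_(r < n) (c r - c r.+1) * \sum_(i < n | (i <= r)%N) z i.
Proof.
under [X in _ + X]eq_bigr do rewrite mulr_sumr.
rewrite (exchange_big_dep predT) //= mulr_sumr -big_split /=.
apply: eq_bigr => i _; rewrite -mulr_suml -mulrDl; congr (_ * _).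
have := telescope_sumr c (ltnW (ltn_ord i)).
rewrite (big_nat_widenl i 0) //= big_mkord => tele.
under eq_bigr do rewrite -opprB; rewrite sumrN tele; ring.
Qed.

(** A nonnegative nonincreasing weight is a nonnegative combination of
    indicators of initial segments, so it preserves the comparison of partial
    sums. *)
Lemma ler_sum_dominated (n : nat) (c : nat -> R) (x y : 'I_n -> R) :
  (forall i, 0 <= c i) -> (forall i j, (i <= j)%N -> c j <= c i) ->
  (forall r, \sum_(i < n | (i <= r)%N) x i <= \sum_(i < n | (i <= r)%N) y i) ->
  \sum_(i < n) c i * x i <= \sum_(i < n) c i * y i.
Proof.
move=> c0 cdec xy; rewrite !abel_summation.
apply: lerD; last by apply: ler_sum => r _; rewrite ler_wpM2l // subr_ge0 cdec.
rewrite ler_wpM2l //.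
have allE (v : 'I_n -> R) : \sum_i v i = \sum_(i < n | (i <= n)%N) v i.
  by apply: eq_bigl => i; rewrite (ltnW (ltn_ord i)).
by rewrite !allE.
Qed.

(** Domination is applied once in each index, which reduces the claim to weights
    that are indicators of initial segments: a corner of [C] has mass at most
    its number of rows and at most its number of columns. *)
Lemma sum_substochastic (n : nat) (a b : nat -> R) (C : 'I_n -> 'I_n -> R) :
  (forall i, 0 <= a i) -> (forall i j, (i <= j)%N -> a j <= a i) ->
  (forall i, 0 <= b i) -> (forall i j, (i <= j)%N -> b j <= b i) ->
  (forall i j, 0 <= C i j) ->
  (forall i, \sum_j C i j <= 1) -> (forall j, \sum_i C i j <= 1) ->
  \sum_(i < n) \sum_(j < n) a i * b j * C i j <= \sum_(i < n) a i * b i.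
Proof.
move=> a0 adec b0 bdec C0 rowC colC.
under eq_bigr do (under eq_bigr do rewrite -mulrA; rewrite -mulr_sumr).
apply: ler_sum_dominated => // r.
rewrite exchange_big /=; under eq_bigr do rewrite -mulr_sumr.
have -> : \sum_(i < n | (i <= r)%N) b i = \sum_(i < n) b i * (i <= r)%N%:R.
  by rewrite big_mkcond; apply: eq_bigr => i _; case: ifP; rewrite ?mulr1 ?mulr0.
apply: ler_sum_dominated => // s.
have rowcol (P Q : pred 'I_n) (D : 'I_n -> 'I_n -> R) :
    (forall i j, 0 <= D i j) -> (forall i, \sum_j D i j <= 1) ->
    \sum_(i | P i) \sum_(j | Q j) D i j <= \sum_(i | P i) 1.
  move=> D0 rowD; apply: ler_sum => i _; apply: le_trans (rowD i).
  by rewrite [leRHS](bigID Q) /= lerDl sumr_ge0.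
have [le_sr|lt_rs] := leqP s r.
  rewrite [leRHS](eq_bigr (fun=> 1)) => [|j js]; last by rewrite (leq_trans js).
  exact: (rowcol _ _ (fun j i => C i j)).
rewrite exchange_big /=; apply: le_trans (rowcol _ _ C C0 rowC) _.
rewrite [leRHS]big_mkcond [leLHS]big_mkcond; apply: ler_sum => i _.
by case: (leqP i r) => [ir|_]; [rewrite (leq_trans ir (ltnW lt_rs))|case: ifP].
Qed.

End Rearrangement.

Section TraceInequality.
Variables (R : realType) (k : scalar_kind) (m n : nat).
Local Notation K := (scalar_field R k).
Local Notation ordl := (widen_ord (geq_minl m n)).
Local Notation ordr := (widen_ord (geq_minr m n)).
Local Notation D := (@rect_diag R k m n).

Lemma rect_diagE (s : nat -> R) :
  D s = \sum_(i < minn m n) of_real k (s i) *: delta_mx (ordl i) (ordr i).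
Proof.
apply/matrixP => i j; rewrite mxE summxE.
case: eqP => [ij|/eqP ij].
  have ip : (i < minn m n)%N by rewrite leq_min ltn_ord ij ltn_ord.
  rewrite (bigD1 (Ordinal ip)) //= !mxE big1 => [|l /eqP li].
    by rewrite addr0 -!val_eqE /= ij !eqxx mulr1.
  rewrite !mxE; case: eqP => [il|_]; rewrite ?mulr0 //=.
  by case: li; apply: val_inj; rewrite /= il.
rewrite big1 // => l _; rewrite !mxE -!val_eqE /=.
case: eqP => [il|_]; rewrite ?mulr0 //=; case: eqP => [jl|_]; rewrite ?mulr0 //.
by rewrite il jl eqxx in ij.
Qed.

Lemma rect_diagD (s t : nat -> R) : D s + D t = D (fun i => s i + t i).
Proof.
by apply/matrixP => i j; rewrite !mxE; case: eqP; rewrite ?addr0 ?rmorphD.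
Qed.

Lemma rect_diagN (s : nat -> R) : - D s = D (fun i => - s i).
Proof.
by apply/matrixP => i j; rewrite !mxE; case: eqP; rewrite ?oppr0 ?rmorphN.
Qed.

Lemma tr_mul_delta (P : 'M[K]_m) (Q : 'M[K]_n) i i' j j' :
  \tr (P *m delta_mx i i' *m Q *m delta_mx j' j) = P j i * Q i' j'.
Proof.
rewrite -(mul_delta_mx (0 : 'I_1) i i') -(mul_delta_mx (0 : 'I_1) j' j).
rewrite !mulmxA mxtrace_mulC !mulmxA -rowE -!mulmxA -colE -rowE mulmxA -colE.
by rewrite /mxtrace !big_ord1 !mxE big_ord1 !mxE.
Qed.

Lemma rdot_suml (I : finType) (A : I -> 'M[K]_(m, n)) B :
  rdot (\sum_i A i) B = \sum_i rdot (A i) B.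
Proof.
apply: (big_morph (fun X => rdot X B) (fun X Y => rdotDl X Y B)).
exact: rdot0.
Qed.

(** The two decompositions interact only through the unitary matrices
    [adjmx U2 *m U1] and [adjmx V1 *m V2]. *)
Lemma rdot_svd (U1 U2 : 'M[K]_m) (V1 V2 : 'M[K]_n) (a b : nat -> R) :
  rdot (U1 *m D a *m adjmx V1) (U2 *m D b *m adjmx V2) =
  \sum_(i < minn m n) \sum_(j < minn m n) a i * b j *
    sRe ((adjmx U2 *m U1) (ordl j) (ordl i) *
         (adjmx V1 *m V2) (ordr i) (ordr j)).
Proof.
rewrite !rect_diagE mulmx_sumr mulmx_suml rdot_suml; apply: eq_bigr => i _.
rewrite mulmx_sumr mulmx_suml rdotC rdot_suml; apply: eq_bigr => j _.
rewrite -!scalemxAr -!scalemxAl !rdotE rdotC mulrCA mulrA; congr (_ * _).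
rewrite /rdot /frob_dot !adjmxM adjmxK adjmx_delta !mulmxA mxtrace_mulC.
rewrite !mulmxA -(mulmxA _ (adjmx V1)).
by rewrite tr_mul_delta.
Qed.

Lemma rdot_svd_same (U : 'M[K]_m) (V : 'M[K]_n) (a b : nat -> R) :
  unitary_mx U -> unitary_mx V ->
  rdot (U *m D a *m adjmx V) (U *m D b *m adjmx V) =
  \sum_(i < minn m n) a i * b i.
Proof.
move=> uU uV; rewrite rdot_svd !unitaryV //; apply: eq_bigr => i _.
rewrite (bigD1 i) //= big1 => [|j ji]; rewrite !mxE -!val_eqE /=.
  by rewrite eqxx mulr1 -(rmorph1 (of_real k)) sRe_of_real mulr1 addr0.
by rewrite [_ == _ :> nat](negbTE ji) mul0r raddf0 mulr0.
Qed.

Lemma sum_sqmod_le1 (p q : nat) (f : 'I_p -> 'I_q) (x : 'I_q -> K) :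
  injective f -> \sum_j sqmod (x j) = 1 -> \sum_i sqmod (x (f i)) <= 1.
Proof.
move=> finj <-; rewrite -(@big_image _ _ _ _ _ f predT (fun j => sqmod (x j))) big_uniq /=.
  by rewrite [leRHS](bigID [in codom f]) /= lerDl sumr_ge0 // => *; exact: sqmod_ge0.
exact/injectiveP.
Qed.

(** The real part of a product of two entries is at most the mean of their
    squared moduli, and the mean of the squared moduli of two unitary matrices
    is doubly substochastic on the common indices. *)
Theorem von_neumann_trace (U1 U2 : 'M[K]_m) (V1 V2 : 'M[K]_n) (a b : nat -> R) :
  unitary_mx U1 -> unitary_mx U2 -> unitary_mx V1 -> unitary_mx V2 ->
  (forall i, 0 <= a i) -> (forall i j, (i <= j)%N -> a j <= a i) ->
  (forall i, 0 <= b i) -> (forall i j, (i <= j)%N -> b j <= b i) ->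
  rdot (U1 *m D a *m adjmx V1) (U2 *m D b *m adjmx V2) <=
  \sum_(i < minn m n) a i * b i.
Proof.
move=> uU1 uU2 uV1 uV2 a0 adec b0 bdec; rewrite rdot_svd.
set P := adjmx U2 *m U1; set Q := adjmx V1 *m V2.
have uP : unitary_mx P by apply: unitaryM => //; exact: unitary_adj.
have uQ : unitary_mx Q by apply: unitaryM => //; exact: unitary_adj.
pose C i j := (sqmod (P (ordl j) (ordl i)) + sqmod (Q (ordr i) (ordr j))) / 2.
have injl : injective (fun i => ordl i) by move=> i j /(congr1 val) ij; apply: val_inj.
have injr : injective (fun i => ordr i) by move=> i j /(congr1 val) ij; apply: val_inj.
apply: (@le_trans _ _ (\sum_(i < minn m n) \sum_(j < minn m n) a i * b j * C i j)).
  do 2![apply: ler_sum => ? _]; rewrite ler_wpM2l ?mulr_ge0 //.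
  exact: sRe_mul_le.
apply: (sum_substochastic a0 adec b0 bdec) => [i j|i|j].
- by rewrite divr_ge0 ?addr_ge0 ?sqmod_ge0.
- rewrite /C -mulr_suml big_split /= ler_pdivrMr // mul1r lerD //.
    by apply: (sum_sqmod_le1 (x := fun j => P j _)) => //; exact: unitary_col.
  by apply: (sum_sqmod_le1 (x := fun j => Q _ j)) => //; exact: unitary_row.
- rewrite /C -mulr_suml big_split /= ler_pdivrMr // mul1r lerD //.
    by apply: (sum_sqmod_le1 (x := fun i => P _ i)) => //; exact: unitary_row.
  by apply: (sum_sqmod_le1 (x := fun i => Q i _)) => //; exact: unitary_col.
Qed.

End TraceInequality.

(** * Existence of singular value decompositions *)

Section Maximisation.
Variables (R : realType) (k : scalar_kind).
Local Notation K := (scalar_field R k).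

Lemma rdot_mean_le (m n : nat) (A B : 'M[K]_(m, n)) :
  rdot A B <= (rdot A A + rdot B B) / 2.
Proof. by have := rdot_ge0 (A - B); rewrite !rdotE (rdotC B A); lra. Qed.

Lemma unitary_cvg_subseq (n : nat) (X : nat -> 'M[K]_n) :
  (forall l, unitary_mx (X l)) ->
  exists2 f : nat -> nat, (forall l, (l <= f l)%N) &
    exists2 U, unitary_mx U & mx_cvg (fun l => X (f l)) U.
Proof.
move=> uX; have [|f lf [U XU]] := @mx_bolzano_weierstrass R k n n X 1.
  move=> l i j; rewrite -(unitary_row i (uX l)) (bigD1 j) //= lerDl.
  by apply: sumr_ge0 => ? _; exact: sqmod_ge0.
by exists f => //; exists U => //; exact: unitary_cvg XU.
Qed.

Lemma tr_mul_delta1 (m n : nat) (A : 'M[K]_(m, n)) (i : 'I_n) (j : 'I_m) :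
  \tr (A *m delta_mx i j) = A j i.
Proof.
rewrite -(mul_delta_mx (0 : 'I_1) i j) mulmxA mxtrace_mulC -colE -rowE.
by rewrite /mxtrace big_ord1 !mxE.
Qed.

(** Unitary matrices form a compact set, so the supremum of the pairing is
    attained: a maximising sequence of pairs has a subsequence along which both
    members converge. *)
Lemma unitary_pair_max (m n : nat) (A W : 'M[K]_(m, n)) :
  exists U V, [/\ unitary_mx U, unitary_mx V & forall U' V',
    unitary_mx U' -> unitary_mx V' ->
    rdot (U' *m A *m adjmx V') W <= rdot (U *m A *m adjmx V) W].
Proof.
pose S := [set x : R | exists U V, [/\ unitary_mx U, unitary_mx V &
  x = rdot (U *m A *m adjmx V) W]].
have supS : has_sup S.
  split; first by eexists; exists 1%:M, 1%:M; split=> //; exact: unitary1.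
  exists ((rdot A A + rdot W W) / 2) => _ [U [V [uU uV ->]]].
  by apply: le_trans (rdot_mean_le _ _) _; rewrite rdot_unitary.
have approx l : exists UV : 'M[K]_m * 'M[K]_n,
    [/\ unitary_mx UV.1, unitary_mx UV.2 &
      sup S - l.+1%:R^-1 < rdot (UV.1 *m A *m adjmx UV.2) W].
  have l0 : 0 < l.+1%:R^-1 :> R by rewrite invr_gt0.
  by have [_ [U [V [uU uV ->]]] ltS] := sup_adherent l0 supS; exists (U, V).
have [UV /all_and3 [uU uV ltS]] := choice approx.
have [f lf [U uUoo cvgU]] := unitary_cvg_subseq uU.
have [g lg [V uVoo cvgV]] := unitary_cvg_subseq (fun l => uV (f l)).
exists U, V; split => // U' V' uU' uV'.
apply: (@le_trans _ _ (sup S)); first by apply: ub_le_sup; [case: supS|exists U', V'].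
have cvgUg := mx_cvg_sub lg cvgU.
have cvg1 := rdot_cvg (mx_cvgM (mx_cvgM cvgUg (@mx_cvg_cst _ _ _ _ A))
  (mx_cvg_adj cvgV)) (@mx_cvg_cst _ _ _ _ W).
have lfg l : (l <= f (g l))%N by exact: leq_trans (lf _).
have cvg2 : sup S - (f (g l)).+1%:R^-1 @[l --> \oo] --> sup S - 0.
  apply: cvgB; first exact: cvg_cst.
  exact: (cvg_cofinal lfg (@cvg_harmonic R)).
rewrite -[sup S]subr0; apply: (ler_cvg_to cvg2 cvg1).
by apply: nearW => l; exact/ltW.
Qed.

End Maximisation.

Section Critical.
Variables (R : realType) (k : scalar_kind) (n : nat) (C : 'M[scalar_field R k]_n).
Local Notation K := (scalar_field R k).
Hypothesis Cmax : forall Q, unitary_mx Q -> sRe (\tr (C *m Q)) <= sRe (\tr C).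

(** A curve of unitary matrices through the identity with velocity proportional
    to [X].  For [kappa = 1] and [t] the tangent of half the angle [theta] it is
    the exponential of [theta X]: the relation on [X] keeps that exponential
    quadratic in [X], and this parametrisation keeps it rational in [t]. *)
Lemma unitary_rotation (X : 'M[K]_n) (kappa t : R) :
  0 <= kappa -> adjmx X = - X -> X *m X *m X = - (of_real k kappa *: X) ->
  let d := 1 + kappa * t ^+ 2 in
  unitary_mx (1%:M + of_real k (2 * t / d) *: X
    + of_real k (2 * t ^+ 2 / d) *: (X *m X)).
Proof.
move=> k0 adjX XXX d.
have d0 : d != 0 by rewrite gt_eqF // ltr_pwDl // mulr_ge0 ?sqr_ge0.
set a := 2 * t / d; set b := 2 * t ^+ 2 / d.
have ab : 2 * b - a ^+ 2 - kappa * b ^+ 2 = 0 by rewrite /a /b /d; field.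
rewrite /unitary_mx !adjmxD !adjmxZ !sconj_of_real adjmx1 adjmxM adjX.
rewrite mulmxN mulNmx opprK; set Y := X *m X.
have XY : X *m Y = - (of_real k kappa *: X) by rewrite mulmxA.
have YY : Y *m Y = - (of_real k kappa *: Y).
  by rewrite {1}/Y -mulmxA XY mulmxN -scalemxAr.
rewrite !mulmxDl !mulmxDr !mul1mx !mulmx1 -!scalemxAl -!scalemxAr.
rewrite !mulmxN XXX XY YY -/Y; clearbody a b Y.
apply/matrixP => i j; rewrite !mxE.
transitivity ((i == j)%:R + of_real k (2 * b - a ^+ 2 - kappa * b ^+ 2) * Y i j).
  by rewrite !rmorphB !rmorphM /= rmorph_nat; ring.
by rewrite ab rmorph0 mul0r addr0.
Qed.

(** Along the curve of [unitary_rotation] the trace has a maximum at [t = 0], so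
    its derivative vanishes there. *)
Lemma max_first_order (X : 'M[K]_n) (kappa : R) :
  0 <= kappa -> adjmx X = - X -> X *m X *m X = - (of_real k kappa *: X) ->
  sRe (\tr (C *m X)) = 0.
Proof.
move=> k0 adjX XXX; set f := sRe _; set g := sRe (\tr (C *m (X *m X))).
have quad t : t * f + t ^+ 2 * g <= 0.
  have := Cmax (unitary_rotation t k0 adjX XXX).
  set d := 1 + _; have d0 : 0 < d by rewrite ltr_pwDl // mulr_ge0 ?sqr_ge0.
  rewrite !mulmxDr mulmx1 -!scalemxAr !mxtraceD !mxtraceZ !raddfD /= !sReZ -/f -/g.
  rewrite -addrA gerDl.
  have -> : 2 * t / d * f + 2 * t ^+ 2 / d * g = (t * f + t ^+ 2 * g) * (2 / d).
    by ring.
  by rewrite pmulr_lle0 // divr_gt0.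
apply/eqP/negPn/negP => f0.
have g1 : 0 < 1 + `|g| by rewrite ltr_pwDl.
(* A step in the direction of the sign of [f], short enough for the linear term
   to dominate the quadratic one. *)
have := quad (f / (1 + `|g|)); apply/negP; rewrite -ltNge.
have -> : f / (1 + `|g|) * f + (f / (1 + `|g|)) ^+ 2 * g =
    (f / (1 + `|g|)) ^+ 2 * (1 + `|g| + g).
  by field; rewrite gt_eqF.
rewrite mulr_gt0 //; first by rewrite exprn_even_gt0 //= mulf_neq0 // invr_eq0 gt_eqF.
by have := ler_norm (- g); rewrite normrN; lra.
Qed.

(** The skew matrix [X] is supported on the entries [(i, j)] and [(j, i)] and is
    chosen so that the derivative in its direction is the squared modulus of
    the defect [C i j - sconj (C j i)]. *)
Lemma max_hermitian : adjmx C = C.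
Proof.
apply/matrixP => i j; rewrite !mxE; apply/esym/eqP; rewrite -subr_eq0; apply/eqP.
set y := C i j - sconj (C j i).
pose X : 'M[K]_n := sconj y *: delta_mx j i - y *: delta_mx i j.
have trX : sRe (\tr (C *m X)) = sqmod y.
  rewrite mulmxBr -!scalemxAr linearB /= !mxtraceZ !tr_mul_delta1 raddfB /=.
  rewrite -[sRe (y * _)]sRe_conj rmorphM /= -raddfB /= -mulrBr -/y.
  by rewrite /sqmod mulrC.
have adjX : adjmx X = - X.
  by rewrite adjmxD adjmxN !adjmxZ !adjmx_delta sconjK opprB.
suff [kappa k0 XXX] : exists2 kappa, 0 <= kappa &
    X *m X *m X = - (of_real k kappa *: X).
  by apply: sqmod_eq0; rewrite -trX; exact: max_first_order XXX.
clearbody y.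
have [ij|ij] := eqVneq i j.
  exists (sqmod (sconj y - y)); first exact: sqmod_ge0.
  rewrite /X ij -scalerBl !(=^~ scalemxAl, =^~ scalemxAr) !mul_delta_mx.
  rewrite !scalerA -scaleNr.
  by congr (_ *: _); rewrite -mul_sconj rmorphB /= sconjK; ring.
exists (sqmod y); first exact: sqmod_ge0.
have dd (a b c d : 'I_n) : delta_mx a b *m delta_mx c d =
    (b == c)%:R *: delta_mx a d :> 'M[K]_n.
  by rewrite mul_delta_mx_cond; case: (b == c); rewrite ?scale1r ?scale0r.
rewrite /X !(mulmxDl, mulmxDr, mulNmx, mulmxN, =^~ scalemxAl, =^~ scalemxAr, dd).
rewrite !eqxx (eq_sym j) (negbTE ij) !scale1r !scale0r.
rewrite -mul_sconj; apply/matrixP => a b; by rewrite !mxE; ring.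
Qed.

(** Test the maximality of the trace on the reflection that negates the basis
    vector [i]. *)
Lemma max_diag_ge0 (i : 'I_n) : 0 <= sRe (C i i).
Proof.
have adjd : adjmx (1%:M - 2 *: delta_mx i i : 'M[K]_n) = 1%:M - 2 *: delta_mx i i.
  by rewrite adjmxD adjmxN adjmxZ adjmx1 adjmx_delta rmorph_nat.
have /Cmax : unitary_mx (1%:M - 2 *: delta_mx i i : 'M[K]_n).
  rewrite /unitary_mx adjd mulmxBl !mulmxBr !mul1mx mulmx1 -!scalemxAl -!scalemxAr.
  by rewrite mul_delta_mx; apply/matrixP => a b; rewrite !mxE; ring.
rewrite mulmxBr mulmx1 -scalemxAr linearB /= mxtraceZ tr_mul_delta1 raddfB /=.
by rewrite -(rmorph_nat (of_real k)) sReZ; lra.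
Qed.

End Critical.

Section SVD.
Variables (R : realType) (k : scalar_kind).
Local Notation K := (scalar_field R k).

Lemma adj_rect_diag (m n : nat) (s : nat -> R) :
  adjmx (@rect_diag R k m n s) = rect_diag k n m s.
Proof.
apply/matrixP => i j; rewrite !mxE [in RHS]eq_sym.
by case: eqP => [->|_]; rewrite ?rmorph0 ?sconj_of_real.
Qed.

Lemma rect_diag_gram (m n : nat) (w : nat -> R) :
  (forall i, (minn m n <= i)%N -> w i = 0) ->
  rect_diag k m n w *m rect_diag k n m w
    = diag_mx (\row_(i < m) of_real k (w i ^+ 2)).
Proof.
move=> w0; apply/matrixP => i j; rewrite !mxE.
have [lt_in|le_ni] := ltnP i n; last first.
  have wi0 : w i = 0 by apply: w0; rewrite geq_min le_ni orbT.
  rewrite wi0 expr0n rmorph0 mul0rn big1 // => l _; rewrite !mxE wi0 rmorph0.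
  by case: ifP => _; rewrite mul0r.
rewrite (bigD1 (Ordinal lt_in)) //= big1 => [|l /eqP li]; rewrite !mxE /=.
  rewrite eqxx addr0 -val_eqE /=.
  by case: eqP; rewrite ?mulr0 // rmorphXn expr2.
case: eqP => [il|]; last by rewrite mul0r.
by case: li; apply: val_inj.
Qed.

Lemma mul_rect_diagr (m n : nat) (B : 'M[K]_(m, n)) (w : nat -> R)
    (i : 'I_n) (l : 'I_m) :
  l = i :> nat -> (rect_diag k n m w *m B) i i = of_real k (w i) * B l i.
Proof.
move=> li; rewrite mxE (bigD1 l) //= big1 => [|h hl]; rewrite !mxE.
  by rewrite li eqxx addr0.
case: eqP => [ih|]; last by rewrite mul0r.
by case/eqP: hl; apply: val_inj; rewrite /= -ih li.
Qed.

Lemma rdot_rect_diag (m n : nat) (B : 'M[K]_(m, n)) (w : nat -> R) :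
  rdot B (rect_diag k m n w) = \sum_(i < minn m n)
    w i * sRe (B (widen_ord (geq_minl m n) i) (widen_ord (geq_minr m n) i)).
Proof.
rewrite rect_diagE rdotC rdot_suml; apply: eq_bigr => i _.
rewrite rdotZl rdotC /rdot /frob_dot adjmx_delta.
by rewrite tr_mul_delta1.
Qed.

Lemma unitary_tperm (n : nat) (i j : 'I_n) : unitary_mx (tperm_mx i j : 'M[K]_n).
Proof.
rewrite /unitary_mx /adjmx /tperm_mx tr_perm_mx tpermV map_perm_mx -perm_mxM.
by rewrite tperm2 perm_mx1.
Qed.

(** Let [B = U *m A *m adjmx V] maximise the pairing with [W = rect_diag w],
    where the weights [w] are strictly decreasing up to index [p] and vanish from
    there on.  Criticality on the right and on the left makes [adjmx W *m B] and
    [B *m adjmx W] Hermitian, hence [W *m adjmx W *m B = B *m adjmx W *m W], that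
    is [w i ^+ 2 * B i j = w j ^+ 2 * B i j]: so [B] is diagonal.  Its diagonal is
    nonnegative by [max_diag_ge0], and decreasing because exchanging two
    diagonal entries does not increase the pairing. *)
Theorem svd_exists (m n : nat) (A : 'M[K]_(m, n)) :
  exists U s V, is_svd A U s V.
Proof.
set p := minn m n.
pose w (i : nat) : R := (p - i)%:R.
have [U [V [uU uV maxUV]]] := unitary_pair_max A (rect_diag k m n w).
have [B BE] : exists B, B = U *m A *m adjmx V by eexists.
have maxB P Q : unitary_mx P -> unitary_mx Q ->
    rdot (P *m B *m Q) (rect_diag k m n w) <= rdot B (rect_diag k m n w).
  move=> uP uQ; have := maxUV _ _ (unitaryM uP uU) (unitaryM (unitary_adj uQ) uV).
  by rewrite adjmxM adjmxK BE !mulmxA.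
pose W := rect_diag k m n w; pose W' := rect_diag k n m w.
have maxr Q : unitary_mx Q -> sRe (\tr (W' *m B *m Q)) <= sRe (\tr (W' *m B)).
  move=> uQ; have := maxB _ _ (unitary1 _ _ _) uQ.
  rewrite mul1mx /rdot /frob_dot adj_rect_diag !(mxtrace_mulC _ (rect_diag _ _ _ _)).
  by rewrite mulmxA.
have maxl P : unitary_mx P -> sRe (\tr (B *m W' *m P)) <= sRe (\tr (B *m W')).
  move=> uP; have := maxB _ _ uP (unitary1 _ _ _).
  rewrite mulmx1 /rdot /frob_dot adj_rect_diag (mxtrace_mulC _ P).
  by rewrite mulmxA.
have hermr : adjmx B *m W = W' *m B.
  by have := max_hermitian maxr; rewrite adjmxM adj_rect_diag.
have herml : W *m adjmx B = B *m W'.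
  by have := max_hermitian maxl; rewrite adjmxM adj_rect_diag.
have w0 i : (p <= i)%N -> w i = 0 by rewrite /w => /eqP ->.
have w0' i : (minn n m <= i)%N -> w i = 0 by rewrite minnC; exact: w0.
have Boff (i : 'I_m) (j : 'I_n) : i != j :> nat -> B i j = 0.
  move=> ij.
  have : W *m W' *m B = B *m (W' *m W).
    by rewrite mulmxA -herml -!mulmxA -hermr.
  rewrite !rect_diag_gram // mul_diag_mx mul_mx_diag => /matrixP /(_ i j).
  rewrite !mxE mulrC => /eqP; rewrite -subr_eq0 -mulrBr mulf_eq0 -rmorphB.
  case/orP=> [/eqP //|].
  rewrite -(rmorph0 (of_real k)) (inj_eq (fmorph_inj _)) subr_eq0.
  rewrite eqrXn2 ?ler0n // eqr_nat; move: ij (ltn_ord i) (ltn_ord j).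
  by rewrite /p; lia.
pose ordl : 'I_p -> 'I_m := widen_ord (geq_minl m n).
pose ordr : 'I_p -> 'I_n := widen_ord (geq_minr m n).
(* The diagonal of [B], extended by zero through an empty sum. *)
pose b i := \sum_(l < p | l == i :> nat) sRe (B (ordl l) (ordr l)).
have bE (l : 'I_p) : b l = sRe (B (ordl l) (ordr l)).
  by rewrite /b (big_pred1 l) // => j; rewrite /= -val_eqE.
have b0 i : (p <= i)%N -> b i = 0.
  move=> pi; rewrite /b big1 // => l /eqP li; have := ltn_ord l.
  by rewrite li ltnNge pi.
have wgt0 (l : 'I_p) : 0 < w l by rewrite /w ltr0n subn_gt0.
have Bdiag (l : 'I_p) : B (ordl l) (ordr l) = of_real k (b l).
  rewrite bE; apply: sconj_fixed.
  have /matrixP /(_ (ordr l) (ordr l)) := max_hermitian maxr.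
  rewrite mxE mxE (@mul_rect_diagr _ _ B w _ (ordl l)) // rmorphM /= sconj_of_real.
  by apply: mulfI; rewrite -(rmorph0 (of_real k)) (inj_eq (fmorph_inj _)) gt_eqF.
have bge0 i : 0 <= b i.
  have [/b0 -> //|lt_ip] := leqP p i.
  have := max_diag_ge0 maxr (ordr (Ordinal lt_ip)).
  rewrite (@mul_rect_diagr _ _ B w _ (ordl (Ordinal lt_ip))) // sReZ.
  by rewrite -bE pmulr_rge0 // wgt0.
have bdec i j : (i <= j)%N -> b j <= b i.
  move=> le_ij; have [/b0 -> //|lt_jp] := leqP p j.
  have [->//|neq_ij] := eqVneq i j.
  have lt_ij : (i < j)%N by lia.
  have lt_ip := ltn_trans lt_ij lt_jp.
  pose i' := Ordinal lt_ip; pose j' := Ordinal lt_jp.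
  have := maxB _ _ (unitary_tperm (ordl i') (ordl j')) (unitary_tperm (ordr i') (ordr j')).
  rewrite -xrowE -xcolE !rdot_rect_diag.
  have ji' : j' != i' by rewrite -val_eqE /= eq_sym.
  rewrite !(bigD1 i' isT) /= !(bigD1 j' ji') /= !mxE !tpermL !tpermR -!/(ordl _) -!/(ordr _).
  rewrite -!bE /=.
  rewrite [X in _ + (_ + X) <= _](eq_bigr (fun l : 'I_p => w l * b l)) => [|l /andP[li lj]].
    rewrite [X in _ <= _ + (_ + X)](eq_bigr (fun l : 'I_p => w l * b l)) => [|l _]; last by rewrite -bE.
    move=> le_ww; have : 0 <= (w i - w j) * (b i - b j) by rewrite /i' /j' /= in le_ww; lra.
    by rewrite pmulr_rge0 ?subr_ge0 // subr_gt0 ltr_nat; lia.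
  by rewrite !mxE !tpermD -?bE // -val_eqE /= eq_sym.
exists (adjmx U), b, (adjmx V); split=> //; try exact: unitary_adj.
have -> : rect_diag k m n b = B.
  apply/matrixP => i j; rewrite mxE; case: eqP => [ij|/eqP/Boff //].
  have lt_ip : (i < p)%N by rewrite leq_min ltn_ord ij ltn_ord.
  rewrite -(Bdiag (Ordinal lt_ip)); congr (B _ _); exact: val_inj.
rewrite adjmxK BE -!mulmxA unitaryV // mulmx1 mulmxA unitaryV //.
by rewrite mul1mx.
Qed.

End SVD.

(** * Singular values, functional calculus and rank *)

Section SingularValues.
Variables (R : realType) (k : scalar_kind) (m n : nat).
Local Notation K := (scalar_field R k).
Local Notation p := (minn m n).
Local Notation D := (@rect_diag R k m n).
Implicit Types (A B : 'M[K]_(m, n)) (s t : nat -> R).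

Lemma svd_von_neumann A B U s V U' t V' :
  is_svd A U s V -> is_svd B U' t V' -> rdot A B <= \sum_(i < p) s i * t i.
Proof.
move=> [uU uV [s0 sdec _] ->] [uU' uV' [t0 tdec _] ->].
exact: von_neumann_trace.
Qed.

Lemma svd_map (f : R -> R) A U s V :
  f 0 = 0 -> (forall x y, 0 <= x -> x <= y -> f x <= f y) ->
  is_svd A U s V -> is_svd (U *m D (f \o s) *m adjmx V) U (f \o s) V.
Proof.
move=> f0 fmono [uU uV [s0 sdec sp] _]; split=> //; split=> /= [j|i j ij|j pj].
- by rewrite -f0 fmono.
- by rewrite fmono // sdec.
- by rewrite sp.
Qed.

(** Pairing [A] with the partial isometry made of its first [r] pairs of singular
    vectors gives the sum of its first [r] singular values, which the trace
    inequality bounds by the same sum for any other decomposition. *)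
Lemma svd_le_partial A U s V U' t V' (r : nat) :
  is_svd A U s V -> is_svd A U' t V' ->
  \sum_(j < p) s j * (j < r)%:R <= \sum_(j < p) t j * (j < r)%:R.
Proof.
move=> [uU uV [s0 sdec sp] AE] [uU' uV' [t0 tdec tp] AE'].
rewrite -(rdot_svd_same s (fun j => (j < r)%:R) uU uV) -AE AE'.
apply: von_neumann_trace => // i j ij; rewrite ler_nat.
by case: (ltnP j r) => // jr; rewrite (leq_ltn_trans ij jr).
Qed.

Lemma svd_values_unique A U s V U' t V' :
  is_svd A U s V -> is_svd A U' t V' -> s = t.
Proof.
move=> svds svdt.
have eq_partial r : \sum_(j < p) s j * (j < r)%:R = \sum_(j < p) t j * (j < r)%:R.
  by apply: le_anti; rewrite (svd_le_partial _ svds svdt) (svd_le_partial _ svdt svds).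
have term (u : nat -> R) i : (i < p)%N ->
    u i = \sum_(j < p) u j * (j < i.+1)%:R - \sum_(j < p) u j * (j < i)%:R.
  move=> ip; rewrite -sumrB (bigD1 (Ordinal ip)) //= ltnSn ltnn mulr1 mulr0 subr0.
  rewrite big1 ?addr0 // => j ji; rewrite -mulrBr ltnS leq_eqVlt.
  by rewrite (negbTE ji : _ == _ :> nat = _) subrr mulr0.
have [_ _ [_ _ sp] _] := svds; have [_ _ [_ _ tp] _] := svdt.
apply/funext => i; have [pi|ip] := leqP p i; first by rewrite sp ?tp.
by rewrite (term s) // (term t) // !eq_partial.
Qed.

Lemma singular_valuesE A U s V : is_svd A U s V -> singular_values A = s.
Proof.
move=> svds; apply: xget_unique; first by exists U, V.
by move=> t [U' [V' svdt]]; exact: svd_values_unique svdt svds.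
Qed.

Lemma singular_valuesP A : exists U V, is_svd A U (singular_values A) V.
Proof.
have [U [s [V svds]]] := svd_exists A.
by exists U, V; rewrite (singular_valuesE svds).
Qed.

Lemma sv_calculusP (f : R -> R) A :
  exists U s V, is_svd A U s V /\ sv_calculus f A = U *m D (f \o s) *m adjmx V.
Proof.
apply: (@xgetPex _ 0 [set B | exists U s V,
  is_svd A U s V /\ B = U *m D (f \o s) *m adjmx V]).
have [U [s [V svds]]] := svd_exists A.
by exists (U *m D (f \o s) *m adjmx V), U, s, V.
Qed.

(** Being nonincreasing, the singular values are nonzero exactly on an initial
    segment, and the decomposition is an invertible multiple of the partial
    identity of that size. *)
Lemma svd_rank A U s V : is_svd A U s V ->
  [/\ (\rank A <= p)%N & forall j, (s j == 0) = (\rank A <= j)%N].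
Proof.
move=> [uU uV [s0 sdec sp] ->].
have ex0 : exists j, s j == 0 by exists p; rewrite sp.
case: (ex_minnP ex0) => r /eqP sr0 rmin.
have sE j : (s j == 0) = (r <= j)%N.
  apply/idP/idP => [/rmin //|rj].
  by rewrite eq_le s0 andbT -sr0 sdec.
have rp : (r <= p)%N by rewrite -sE sp.
suff -> : \rank (U *m D s *m adjmx V) = r by [].
have unit_unitary q (X : 'M[K]_q) : unitary_mx X -> X \in unitmx.
  by move=> /mulmx1_unit [].
rewrite mxrankMfree ?row_free_unit ?unit_unitary //; last exact: unitary_adj.
rewrite (eqmxMfull _ (_ : row_full U)) ?row_full_unit ?unit_unitary //.
have -> : D s = diag_mx (\row_i of_real k (if (i < r)%N then s i else 1))
    *m pid_mx r.
  apply/matrixP => i j; rewrite mul_diag_mx !mxE.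
  case: eqP => _ /=; last by rewrite mulr0.
  case: ltnP => [_|]; first by rewrite mulr1.
  by rewrite mulr0 -sE => /eqP ->; rewrite rmorph0.
rewrite (eqmxMfull _ (_ : row_full (diag_mx _))) ?rank_pid_mx //.
- by rewrite (leq_trans rp) ?geq_minl.
- by rewrite (leq_trans rp) ?geq_minr.
rewrite row_full_unit unitmxE det_diag unitfE; apply/prodf_neq0 => i _; rewrite mxE.
rewrite -(rmorph0 (of_real k)) (inj_eq (fmorph_inj _)).
by case: ltnP => [ir|_]; rewrite ?oner_neq0 // sE -ltnNge.
Qed.

End SingularValues.

(** * Orthogonal projections *)

Section OrthogonalProjection.
Variables (R : realType) (k : scalar_kind) (m n : nat).
Local Notation K := (scalar_field R k).
Local Notation MMN := 'M[K]_(m, n).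
Implicit Types (A B C : MMN) (H : {vspace MMN}).

Lemma frob_dotDl A B C : frob_dot (A + B) C = frob_dot A C + frob_dot B C.
Proof. by rewrite /frob_dot mulmxDl linearD. Qed.

Lemma frob_dotZl a A B : frob_dot (a *: A) B = a * frob_dot A B.
Proof. by rewrite /frob_dot -scalemxAl mxtraceZ. Qed.

Lemma frob_dotC A B : frob_dot A B = sconj (frob_dot B A).
Proof.
rewrite /frob_dot /mxtrace rmorph_sum; apply: eq_bigr => i _.
rewrite !mxE rmorph_sum; apply: eq_bigr => j _.
by rewrite !mxE rmorphM /= sconjK mulrC.
Qed.

Lemma frob_dotDr A B C : frob_dot C (A + B) = frob_dot C A + frob_dot C B.
Proof. by rewrite frob_dotC frob_dotDl rmorphD /= -!frob_dotC. Qed.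

Lemma frob_dotZr a A B : frob_dot B (a *: A) = sconj a * frob_dot B A.
Proof. by rewrite frob_dotC frob_dotZl rmorphM /= -!frob_dotC. Qed.

Lemma orth_complB H A B : orth_compl [set` H] A -> orth_compl [set` H] B ->
  orth_compl [set` H] (A - B).
Proof.
move=> HA HB X HX.
by rewrite -scaleN1r frob_dotDl frob_dotZl HA // HB // mulr0 addr0.
Qed.

Lemma orth_complC H A X : orth_compl [set` H] A -> X \in H -> frob_dot X A = 0.
Proof. by move=> HA HX; rewrite frob_dotC HA // rmorph0. Qed.

Lemma orth_rdot H A X : orth_compl [set` H] A -> X \in H -> rdot A X = 0.
Proof. by move=> HA HX; rewrite /rdot HA // raddf0. Qed.

(** One step of Gram-Schmidt: the new vector [x] is replaced by its component
    [x'] orthogonal to the span of the others. *)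
Lemma span_decomposition (X : seq MMN) W :
  exists2 h, h \in <<X>>%VS & orth_compl [set` <<X>>%VS] (W - h).
Proof.
elim: X W => [|x X IH] W.
  exists 0; first exact: mem0v.
  move=> y /=; rewrite span_nil memv0 => /eqP ->.
  by rewrite -(scale0r 0) frob_dotZr rmorph0 mul0r.
have [hx hxX ox] := IH x; have [h hX oh] := IH W.
set x' := x - hx in ox.
have spanS y : y \in <<X>>%VS -> y \in <<x :: X>>%VS.
  by rewrite span_cons; apply/subvP; exact: addvSr.
have xS : x \in <<x :: X>>%VS.
  by rewrite span_cons (subvP (addvSl _ _)) ?memv_line.
(* If [x'] is zero then so is [c], and [h] is already the projection. *)
pose c := frob_dot (W - h) x' / frob_dot x' x'.
exists (h + c *: x').
  by apply: memvD; [exact: spanS|apply/memvZ/memvB => //; exact: spanS].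
have cx' : frob_dot (W - h) x' = c * frob_dot x' x'.
  have [x0|x0] := eqVneq (frob_dot x' x') 0; last by rewrite divfK.
  have -> : x' = 0 by apply: rdot_eq0; rewrite /rdot x0 raddf0.
  by rewrite -(scale0r 0) !frob_dotZr rmorph0 !mul0r mulr0.
move=> y /=; rewrite span_cons => /memv_addP [_ /vlineP [a ->] [z zX ->]].
have -> : a *: x + z = a *: x' + (a *: hx + z) by rewrite scalerBr addrA subrK.
have : a *: hx + z \in <<X>>%VS by rewrite memvD ?memvZ.
move: (a *: hx + z) => z' zX'; rewrite opprD addrA -scaleNr frob_dotDl !frob_dotDr !frob_dotZl.
rewrite (oh _ zX') (ox _ zX') !frob_dotZr cx'; ring.
Qed.

Lemma orth_decomposition H W :
  exists2 h, h \in H & orth_compl [set` H] (W - h).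
Proof.
by have := span_decomposition (vbasis H) W; rewrite (span_basis (vbasisP H)).
Qed.

Lemma orth_projP H W :
  orth_proj [set` H] W \in H /\ orth_compl [set` H] (W - orth_proj [set` H] W).
Proof.
apply: (@xgetPex _ 0 [set P | [set` H] P /\ orth_compl [set` H] (W - P)]).
by have [h hH oh] := orth_decomposition H W; exists h.
Qed.

(** Two projections of [W] onto the complement of [H] differ by an element of
    that complement which is also orthogonal to it. *)
Lemma orth_proj_compl H W :
  orth_proj (orth_compl [set` H]) W = W - orth_proj [set` H] W.
Proof.
have [PH oP] := orth_projP H W; set P := orth_proj _ W in PH oP *.
apply: xget_unique => [|Q [oQ ooQ]].
  by split=> //= X oX; rewrite opprB addrC subrK; exact: orth_complC oX PH.
have oD : orth_compl [set` H] (Q - (W - P)) by exact: orth_complB.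
apply/eqP; rewrite -subr_eq0; apply/eqP; apply: rdot_eq0.
have := ooQ _ oD; set D := Q - _ in oD *.
have -> : W - Q = P - D by rewrite /D opprB addrA addrCA subrr addr0 addrC.
rewrite -scaleN1r frob_dotDl (orth_complC oD PH) add0r frob_dotZl mulN1r.
by move=> /eqP; rewrite oppr_eq0 /rdot => /eqP ->; rewrite raddf0.
Qed.

End OrthogonalProjection.

(** * Picard iteration of averaged maps *)

Section PicardIteration.
Variables (R : realType) (k : scalar_kind) (m n : nat).
Local Notation K := (scalar_field R k).
Local Notation MMN := 'M[K]_(m, n).

Lemma sqr_norm_sqmod (x : K) : `|x| ^+ 2 = of_real k (sqmod x).
Proof.
rewrite /sqmod; case: (k) x => /= x; first by rewrite real_normK ?num_real.
by rewrite sqr_normc; case: x => a b; simpc; congr Complex; ring.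
Qed.

Lemma mx_cvg_rdot (X : nat -> MMN) (L : MMN) :
  rdot (X l - L) (X l - L) @[l --> \oo] --> (0 : R) -> mx_cvg X L.
Proof.
move=> XL i j; apply/cvgrPdist_lt => e e0; rewrite -(gt0_of_real e0).
have e'0 : 0 < sRe e by rewrite -(ltr_of_real k) gt0_of_real // rmorph0.
near=> l.
rewrite distrC -(ltr_pXn2r (isT : (0 < 2)%N)) ?nnegrE ?normr_ge0 //; last first.
  by rewrite gt0_of_real // ltW.
rewrite sqr_norm_sqmod -rmorphXn ltr_of_real.
have -> : X l i j - L i j = (X l - L) i j by rewrite !mxE.
rewrite (le_lt_trans (sqmod_le_rdot _ _ _)) //.
rewrite -[ltLHS]ger0_norm ?rdot_ge0 // -[X in `|X|]subr0 distrC.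
near: l; move/cvgrPdist_lt: XL; apply; exact: exprn_gt0.
Unshelve. all: by end_near. Qed.

Variables (T : MMN -> MMN) (c : R).
Hypothesis c_gt0 : 0 < c.
Hypothesis averaged : forall X Y,
  rdot (T X - T Y) (T X - T Y) +
    c * rdot ((X - T X) - (Y - T Y)) ((X - T X) - (Y - T Y)) <=
  rdot (X - Y) (X - Y).

Lemma averaged_nonexpansive X Y :
  rdot (T X - T Y) (T X - T Y) <= rdot (X - Y) (X - Y).
Proof.
apply: le_trans (averaged X Y); rewrite lerDl mulr_ge0 ?rdot_ge0 //; exact: ltW.
Qed.

Lemma iter_cvg (X : nat -> MMN) (L : MMN) (i : nat) :
  mx_cvg X L -> mx_cvg (fun l => iter i T (X l)) (iter i T L).
Proof.
move=> XL; apply: mx_cvg_rdot.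
have XL0 := mx_cvgB XL (@mx_cvg_cst _ _ _ _ L).
have := rdot_cvg XL0 XL0.
rewrite subrr rdot0 => N0.
apply: (squeeze_cvgr _ (cvg_cst 0) N0); apply: nearW => l; rewrite rdot_ge0 /=.
elim: i => //= i; apply: le_trans; exact: averaged_nonexpansive.
Qed.

(** Equal lengths of two consecutive steps force the averagedness defect to
    vanish, and this is a multiple of the squared length of their difference.  So all steps are equal, the
    orbit is an arithmetic progression, and it is bounded only if the step is
    zero. *)
Lemma constant_speed_fixed (L : MMN) (delta C : R) :
  (forall i, rdot (iter i.+1 T L - iter i T L) (iter i.+1 T L - iter i T L) = delta) ->
  (forall i, rdot (iter i T L) (iter i T L) <= C) -> T L = L.
Proof.
move=> speed bounded.
have step i : iter i.+2 T L - iter i.+1 T L = iter i.+1 T L - iter i T L.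
  have := averaged (iter i.+1 T L) (iter i T L).
  rewrite -/(iter i.+2 T L) -/(iter i.+1 T L) !speed gerDl pmulr_rle0 // => le0.
  have /rdot_eq0 : rdot (iter i.+1 T L - iter i.+2 T L - (iter i T L - iter i.+1 T L))
      (iter i.+1 T L - iter i.+2 T L - (iter i T L - iter i.+1 T L)) = 0.
    by apply: le_anti; rewrite le0 rdot_ge0.
  by move=> /subr0_eq /(congr1 -%R); rewrite !opprB.
have speedE i : iter i.+1 T L - iter i T L = T L - L.
  by elim: i => // i <-; exact: step.
have iterE i : iter i T L = L + of_real k i%:R *: (T L - L).
  elim: i => [|i IH]; first by rewrite rmorph0 scale0r addr0.
  rewrite -[LHS](subrK (iter i T L)) speedE IH -natr1 rmorphD rmorph1 scalerDl scale1r.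
  by rewrite addrC -addrA.
have [v vE] : exists v, v = T L - L by eexists.
rewrite -vE in iterE.
(* By the parallelogram inequality, [i *: v] being the difference of two points
   of the orbit. *)
have grow i : i%:R ^+ 2 * rdot v v <= 4 * C.
  have := bounded i; have := bounded 0%N; rewrite /= iterE !rdotE (rdotC v L).
  have := rdot_ge0 (of_real k 2 *: L + of_real k i%:R *: v).
  rewrite !rdotE (rdotC v L); nra.
apply/eqP; rewrite -subr_eq0 -vE; apply/eqP/rdot_eq0/eqP/negPn/negP => v0.
have vgt0 : 0 < rdot v v by rewrite lt_def v0 rdot_ge0.
pose i := (Num.bound `|4 * C / rdot v v|).+1.
have := grow i; apply/negP; rewrite -ltNge -ltr_pdivrMr //.
apply: (@lt_le_trans _ _ i%:R).
  apply: le_lt_trans (ler_norm _) _; apply: lt_trans (archi_boundP _) _ => //.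
  by rewrite ltr_nat.
by rewrite expr2 ler_peMr // ler1n.
Qed.

(** The steps of the orbit have nonincreasing lengths, so any limit [L] of a
    subsequence has an orbit of constant speed and is a fixed point; the distance
    to [L] is nonincreasing along the orbit and tends to zero along the
    subsequence. *)
Theorem picard_averaged (x0 : MMN) (C : R) :
  (forall i, rdot (iter i T x0) (iter i T x0) <= C) ->
  exists2 L, T L = L &
    frob_norm (iter i T x0 - L) @[i --> \oo] --> (0 : R).
Proof.
move=> bounded; pose x i := iter i T x0.
have [l i j|f lf [L xL]] := @mx_bolzano_weierstrass R k m n x C.
  exact: le_trans (sqmod_le_rdot _ _ _) (bounded l).
pose d i := rdot (x i.+1 - x i) (x i.+1 - x i).
have cvg_d : d @ \oo --> limn d.
  apply: nonincreasing_is_cvgn.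
    by apply/nonincreasing_seqP => i; exact: averaged_nonexpansive.
  by exists 0 => _ [i _ <-]; exact: rdot_ge0.
have xfL i : mx_cvg (fun l => x (i + f l)%N) (iter i T L).
  by under eq_fun do rewrite /x iterD; exact: iter_cvg.
have fixL : T L = L.
  apply: (@constant_speed_fixed L (limn d) C) => i.
    apply: (@cvg_unique R _ (d (i + f l)%N @[l --> \oo])) => //.
      by apply: rdot_cvg; apply: mx_cvgB; [exact: (xfL i.+1)|exact: xfL|exact: (xfL i.+1)|exact: xfL].
    by apply: (cvg_cofinal _ cvg_d) => l; rewrite (leq_trans (lf l)) ?leq_addl.
  apply: (ler_cvg_to (rdot_cvg (xfL i) (xfL i)) (cvg_cst C)).
  by apply: nearW => l; exact: bounded.
exists L => //.
pose e i := rdot (x i - L) (x i - L).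
have cvg_e : e @ \oo --> limn e.
  apply: nonincreasing_is_cvgn.
    by apply/nonincreasing_seqP => i; rewrite /e -{1 2}fixL; exact: averaged_nonexpansive.
  by exists 0 => _ [i _ <-]; exact: rdot_ge0.
have e0 : limn e = 0.
  apply: (@cvg_unique R _ (e (f l) @[l --> \oo])) => //.
    exact: cvg_cofinal cvg_e.
  have xL0 := mx_cvgB xL (@mx_cvg_cst _ _ _ _ L).
  by have := rdot_cvg xL0 xL0; rewrite subrr rdot0.
rewrite e0 in cvg_e.
have := continuous_cvg _ (@sqrt_continuous R 0) cvg_e.
by rewrite sqrtr0; apply.
Qed.

End PicardIteration.

(** * The scalar penalty and its proximal map *)

(** The contribution of a singular value [x] to [R_pen tau]. *)
Definition penalty (R : realType) (tau x : R) : R :=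
  tau ^+ 2 - Num.max (tau - x) 0 ^+ 2.

Section ScalarFunctions.
Variables (R : realType) (tau : R).
Hypothesis tau_gt0 : 0 < tau.
Local Notation s := (s_fun tau 2).
Local Notation g := (penalty tau).

Variant s_fun_spec (x : R) : R -> Type :=
| SFunLow of x <= tau : s_fun_spec x x
| SFunMid of tau <= x <= 2 * tau : s_fun_spec x tau
| SFunHigh of 2 * tau <= x : s_fun_spec x (x / 2).

Lemma s_funP (x : R) : 0 <= x -> s_fun_spec x (s x).
Proof.
move=> x0; rewrite /s_fun; have [xt|tx] := lerP x tau.
  by rewrite max_l; [exact: SFunLow|lra].
have [le|lt] := lerP (x / 2) tau; first by apply: SFunMid; lra.
by apply: SFunHigh; lra.
Qed.

Lemma s_fun0 : s 0 = 0.
Proof. by case: s_funP => //; lra. Qed.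

Lemma s_fun_mono (x y : R) : 0 <= x -> x <= y -> s x <= s y.
Proof.
move=> x0 xy; have y0 := le_trans x0 xy.
by case: (s_funP x0) => ?; case: (s_funP y0) => ?; lra.
Qed.

Lemma s_fun_residual_mono (x y : R) : 0 <= x -> x <= y -> x - s x <= y - s y.
Proof.
move=> x0 xy; have y0 := le_trans x0 xy.
by case: (s_funP x0) => ?; case: (s_funP y0) => ?; lra.
Qed.

Lemma sqr_s_fun_le (x : R) : 0 <= x -> s x ^+ 2 <= tau ^+ 2 + x ^+ 2 / 4.
Proof. by move=> x0; case: s_funP => // ?; nra. Qed.

(** The function [penalty tau x + x ^+ 2] is convex on the half-line, equal to
    [2 * tau * x] up to [tau] and to [tau ^+ 2 + x ^+ 2] from there on;
    [2 * s y] is one of its slopes at [y - s y].  At 0 the slopes are all numbers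
    up to [2 * tau], which is where small [y] go. *)
Lemma penalty_subgradient (y b : R) : 0 <= y -> 0 <= b ->
  g (y - s y) + (y - s y) ^+ 2 + 2 * s y * (b - (y - s y)) <= g b + b ^+ 2.
Proof.
move=> y0 b0; rewrite /penalty.
have [bt|tb] := lerP (tau - b) 0; case: (s_funP y0) => [yt|/andP[ty yt]|ty].
- by rewrite subrr subr0 max_l ?(ltW tau_gt0) //; nra.
- by rewrite max_l; [nra|lra].
- by rewrite max_r; [have := sqr_ge0 (b - y / 2); nra|lra].
- by rewrite subrr subr0 max_l ?(ltW tau_gt0) //; nra.
- by rewrite max_l; [nra|lra].
- by rewrite max_r; [nra|lra].
Qed.

Lemma penalty_le (x : R) : g x <= tau ^+ 2.
Proof. by rewrite lerBlDr lerDl sqr_ge0. Qed.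

Lemma penalty0 : g 0 = 0.
Proof. by rewrite /penalty subr0 max_l ?(ltW tau_gt0) // subrr. Qed.

Lemma penalty_saturated (x : R) : tau <= x -> g x = tau ^+ 2.
Proof. by move=> tx; rewrite /penalty max_r ?subr_le0 // expr0n subr0. Qed.

(** The value [tau] is the one that [s] takes on the whole interval from [tau] to
    [2 * tau], the only place where the residual lies strictly between 0 and
    [tau]. *)
Lemma s_fun_neq_tau (y : R) : 0 <= y -> s y <> tau ->
  y - s y = 0 \/ tau <= y - s y.
Proof.
move=> y0; case: s_funP => // yt; first by left; rewrite subrr.
by move=> _; right; lra.
Qed.

End ScalarFunctions.

(** * The singular value calculus as a proximal map *)

Section Penalty.
Variables (R : realType) (k : scalar_kind) (m n : nat) (tau : R).
Hypothesis tau_gt0 : 0 < tau.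
Local Notation K := (scalar_field R k).
Local Notation MMN := 'M[K]_(m, n).
Local Notation p := (minn m n).
Local Notation D := (@rect_diag R k m n).
Local Notation g := (penalty tau).
Local Notation s := (s_fun tau 2).

Lemma svd_residual (f : R -> R) (A : MMN) U t V :
  is_svd A U t V ->
  A - U *m D (f \o t) *m adjmx V = U *m D ((fun x => x - f x) \o t) *m adjmx V.
Proof.
move=> [_ _ _ ->].
by rewrite -mulmxBl -mulmxBr rect_diagN rect_diagD.
Qed.

Lemma svd_rdot (A : MMN) U t V : is_svd A U t V -> rdot A A = \sum_(i < p) t i ^+ 2.
Proof. by move=> [uU uV _ ->]; rewrite rdot_svd_same. Qed.

(** The claim is that [SA - SB] pairs nonnegatively with the difference of the
    residuals [A - SA] and [B - SB].  The diagonal terms of this pairing are sums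
    over singular values, the cross terms are bounded by the trace inequality, and
    what remains is a sum of products of two increments of the same sign. *)
Lemma sv_calculus_firm (f : R -> R) (A B : MMN) :
  f 0 = 0 -> (forall x y, 0 <= x -> x <= y -> f x <= f y) ->
  (forall x y, 0 <= x -> x <= y -> x - f x <= y - f y) ->
  let S := sv_calculus f A - sv_calculus f B in rdot S S <= rdot S (A - B).
Proof.
move=> f0 fmono rmono.
have [U [t [V [svdA ->]]]] := sv_calculusP f A.
have [U' [t' [V' [svdB ->]]]] := sv_calculusP f B.
set SA := U *m _ *m _; set SB := U' *m _ *m _.
have svdSA : is_svd SA U (f \o t) V := svd_map f0 fmono svdA.
have svdSB : is_svd SB U' (f \o t') V' := svd_map f0 fmono svdB.
have r0 : 0 - f 0 = 0 by rewrite f0 subr0.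
have := svd_map r0 rmono svdA; rewrite -(svd_residual f svdA) -/SA => svdRA.
have := svd_map r0 rmono svdB; rewrite -(svd_residual f svdB) -/SB => svdRB.
have dAA : rdot SA (A - SA) = \sum_(i < p) f (t i) * (t i - f (t i)).
  by case: svdSA svdRA => uU uV _ -> [_ _ _ ->]; rewrite rdot_svd_same.
have dBB : rdot SB (B - SB) = \sum_(i < p) f (t' i) * (t' i - f (t' i)).
  by case: svdSB svdRB => uU uV _ -> [_ _ _ ->]; rewrite rdot_svd_same.
have dAB := svd_von_neumann svdSA svdRB; have dBA := svd_von_neumann svdSB svdRA.
have : 0 <= \sum_(i < p) (f (t i) - f (t' i)) *
    ((t i - f (t i)) - (t' i - f (t' i))).
  apply: sumr_ge0 => i _.
  case: svdA => _ _ [t0 _ _] _; case: svdB => _ _ [t'0 _ _] _.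
  have [le|/ltW le] := lerP (t i) (t' i).
    by rewrite mulr_le0 // subr_le0; [exact: fmono|exact: rmono].
  by rewrite mulr_ge0 // subr_ge0; [exact: fmono|exact: rmono].
have -> : \sum_(i < p) (f (t i) - f (t' i)) * ((t i - f (t i)) - (t' i - f (t' i)))
   = \sum_(i < p) f (t i) * (t i - f (t i)) + \sum_(i < p) f (t' i) * (t' i - f (t' i))
     - \sum_(i < p) f (t i) * (t' i - f (t' i))
     - \sum_(i < p) f (t' i) * (t i - f (t i)).
  by rewrite -big_split -!sumrB; apply: eq_bigr => i _ /=; ring.
move: dAB dBA; rewrite /= -dAA -dBB.
move: (\sum_(i < p) _) (\sum_(i < p) _) => ab ba.
by rewrite !rdotE (rdotC SB SA); lra.
Qed.

Lemma R_penE (A : MMN) U t V :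
  is_svd A U t V -> R_pen tau A = \sum_(i < p) g (t i).
Proof. by move=> svdA; rewrite /R_pen (singular_valuesE svdA). Qed.

Lemma R_pen_le_rank (A : MMN) : R_pen tau A <= tau ^+ 2 * (\rank A)%:R.
Proof.
have [U [V svdA]] := singular_valuesP A; set t := singular_values A in svdA.
have [rp tE] := svd_rank svdA; have [_ _ [t0 _ _] _] := svdA.
rewrite (R_penE svdA) mulr_natr -[in leRHS](card_ord (\rank A)) -sumr_const.
rewrite (big_ord_widen _ (fun=> tau ^+ 2) rp) [leRHS]big_mkcond.
apply: ler_sum => j _; case: ltnP => [_|]; first exact: penalty_le.
by rewrite -tE => /eqP ->; rewrite penalty0.
Qed.

(** The penalty has saturated at all nonzero singular values. *)
Lemma R_pen_eq_rank (A : MMN) U t V : is_svd A U t V ->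
  (forall j : 'I_p, t j = 0 \/ tau <= t j) ->
  R_pen tau A = tau ^+ 2 * (\rank A)%:R.
Proof.
move=> svdA gap; have [rp tE] := svd_rank svdA.
rewrite (R_penE svdA) mulr_natr -[in RHS](card_ord (\rank A)) -sumr_const.
rewrite (big_ord_widen _ (fun=> tau ^+ 2) rp) [RHS]big_mkcond.
apply: eq_bigr => j _; case: ltnP => [|]; last first.
  by rewrite -tE => /eqP ->; rewrite penalty0.
rewrite ltnNge -tE => /eqP tj0.
by case: (gap j) => // ?; exact: penalty_saturated.
Qed.

(** All matrices on the left share the singular vectors of [Y], so only the
    pairing of [W] with [B] needs the trace inequality; the scalar inequality
    [penalty_subgradient] is then summed over the singular values. *)
Lemma prox_subgradient (Y W : MMN) U y V : is_svd Y U y V ->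
  W = U *m D (s \o y) *m adjmx V ->
  forall B, R_pen tau (Y - W) + rdot (Y - W) (Y - W)
              + 2 * rdot W (B - (Y - W)) <= R_pen tau B + rdot B B.
Proof.
move=> svdY WE B.
have svdW : is_svd W U (s \o y) V.
  by rewrite WE; apply: svd_map svdY; [exact: s_fun0|exact: s_fun_mono].
have svdA : is_svd (Y - W) U ((fun x => x - s x) \o y) V.
  rewrite WE (svd_residual _ svdY); apply: svd_map svdY.
    by rewrite s_fun0 ?subr0.
  exact: s_fun_residual_mono.
have [U' [V' svdB]] := singular_valuesP B; set b := singular_values B in svdB.
have dWA : rdot W (Y - W) = \sum_(i < p) s (y i) * (y i - s (y i)).
  by case: svdW svdA => uU uV _ -> [_ _ _ ->]; rewrite rdot_svd_same.
have := svd_von_neumann svdW svdB.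
rewrite (R_penE svdA) (R_penE svdB) (svd_rdot svdA) (svd_rdot svdB).
rewrite rdotDr rdotNr dWA => vn.
apply: (@le_trans _ _ (\sum_(i < p) (g (y i - s (y i)) + (y i - s (y i)) ^+ 2)
    + 2 * (\sum_(i < p) s (y i) * (b i - (y i - s (y i)))))).
  rewrite [X in _ <= X + _]big_split lerD2l ler_pM2l //=.
  under [leRHS]eq_bigr do rewrite mulrBr.
  by rewrite sumrB lerD2r.
rewrite mulr_sumr -!big_split; apply: ler_sum => i _ /=.
rewrite mulrA; apply: penalty_subgradient => //.
  by case: svdY => _ _ [].
by case: svdB => _ _ [].
Qed.

End Penalty.

(** * Fixed points of the operator *)

Section FixedPoints.
Variables (R : realType) (k : scalar_kind) (m n : nat).
Local Notation K := (scalar_field R k).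
Local Notation MMN := 'M[K]_(m, n).
Variables (H : {vspace MMN}) (F : MMN) (tau : R).
Hypotheses (FH : F \in H) (tau_gt0 : 0 < tau).
Local Notation T := (B_op H F tau 2).
Local Notation PH := (orth_proj [set` H]).
Local Notation s := (s_fun tau 2).

Lemma B_opE W : T W = sv_calculus s (2 *: F + (W - PH W)).
Proof. by rewrite /B_op orth_proj_compl rmorph_nat. Qed.

(** Split [X - Y = a + h] along the complement of [H] and [H].  Firmness of the
    singular value calculus controls [S] against [a] only; the parallelogram
    inequality for [a - S] and [h] accounts for the constant [1 / 2]. *)
Lemma B_op_averaged (X Y : MMN) :
  rdot (T X - T Y) (T X - T Y) +
    2^-1 * rdot ((X - T X) - (Y - T Y)) ((X - T X) - (Y - T Y)) <=
  rdot (X - Y) (X - Y).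
Proof.
have := sv_calculus_firm (2 *: F + (X - PH X)) (2 *: F + (Y - PH Y))
  (s_fun0 tau) (@s_fun_mono _ tau) (@s_fun_residual_mono _ tau).
rewrite /= -!B_opE; set S := T X - T Y.
have [PX oX] := orth_projP H X; have [PY oY] := orth_projP H Y.
set a := (X - PH X) - (Y - PH Y); set h := PH X - PH Y.
have ah : rdot a h = 0 by apply: (orth_rdot (orth_complB oX oY)); exact: memvB.
have -> : 2 *: F + (X - PH X) - (2 *: F + (Y - PH Y)) = a.
  by rewrite opprD addrACA subrr add0r.
have -> : X - T X - (Y - T Y) = a + h - S.
  by apply/matrixP => i j; rewrite !mxE; ring.
have -> : X - Y = a + h by apply/matrixP => i j; rewrite !mxE; ring.
clearbody a h S; have := rdot_ge0 (a - S - h).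
by rewrite !rdotE (rdotC h a) (rdotC S a) (rdotC S h) ah; lra.
Qed.

(** The square of [s x] is at most [tau ^+ 2 + x ^+ 2 / 4], and [2 *: F] is
    orthogonal to the component of [W] that enters the operator. *)
Lemma B_op_norm_le (W : MMN) :
  rdot (T W) (T W) <= (minn m n)%:R * tau ^+ 2 + rdot F F + rdot W W / 4.
Proof.
rewrite B_opE; have [U [y [V [svdY ->]]]] := sv_calculusP s (2 *: F + (W - PH W)).
have svdT := svd_map (s_fun0 tau) (@s_fun_mono _ tau) svdY.
have [PW oW] := orth_projP H W.
have := svd_rdot svdY; rewrite (svd_rdot svdT) => normY.
apply: (@le_trans _ _ (\sum_(i < minn m n) (tau ^+ 2 + y i ^+ 2 / 4))).
  by apply: ler_sum => i _; apply: sqr_s_fun_le => //; case: svdY => _ _ [].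
rewrite big_split /= sumr_const card_ord -mulr_suml -normY mulr_natl -addrA lerD2l.
have oF := orth_rdot oW FH; have oP := orth_rdot oW PW.
move: oF oP; set P := PH W; set Q := W - P => oF oP.
have WE : W = Q + P by rewrite subrK.
clearbody P Q; rewrite -(rmorph_nat (of_real k)) WE.
rewrite !rdotE oP oF (rdotC F) oF (rdotC P) oP.
by have := rdot_ge0 P; lra.
Qed.

Lemma B_op_iter_bounded (W : MMN) : exists C, forall i,
  rdot (iter i T W) (iter i T W) <= C.
Proof.
pose c := (minn m n)%:R * tau ^+ 2 + rdot F F.
have c0 : 0 <= c by rewrite addr_ge0 ?rdot_ge0 // mulr_ge0 ?sqr_ge0.
have W0 := rdot_ge0 W.
(* Any bound that is at least [4 / 3 * c] is preserved by [x |-> c + x / 4]. *)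
exists (rdot W W + 2 * c); elim=> [|i IH] /=; first lra.
by have := B_op_norm_le (iter i T W); rewrite -/c; lra.
Qed.

Variables (Wo : MMN).
Hypothesis fixWo : T Wo = Wo.
Local Notation Ao := (2 *: F - PH Wo).

Lemma fixed_point_svd : exists U y V,
  [/\ is_svd (2 *: F + (Wo - PH Wo)) U y V,
      Wo = U *m rect_diag k m n (s \o y) *m adjmx V &
      Ao = 2 *: F + (Wo - PH Wo) - Wo].
Proof.
have [U [y [V [svdY WoE]]]] := sv_calculusP s (2 *: F + (Wo - PH Wo)).
exists U, y, V; split=> //; first by rewrite -WoE -B_opE.
by apply/matrixP => i j; rewrite !mxE; ring.
Qed.

Lemma fixed_point_subgradient B :
  R_pen tau Ao + rdot Ao Ao + 2 * rdot Wo (B - Ao) <= R_pen tau B + rdot B B.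
Proof.
have [U [y [V [svdY WoE ->]]]] := fixed_point_svd.
exact: (prox_subgradient tau_gt0 svdY WoE).
Qed.

Lemma fixed_point_mem : Ao \in H.
Proof. by rewrite memvB ?memvZ //; case: (orth_projP H Wo). Qed.

(** The objective is [R_pen tau B + rdot B B], with half a subgradient [Wo] at
    [Ao], plus a quadratic function of [B].  The first-order terms cancel up to
    the pairing of [Wo - PH Wo] with [B - Ao], which is zero on [H], and the
    quadratic part leaves [rdot (B - Ao) (B - Ao)]. *)
Lemma fixed_point_gap B : B \in H ->
  R_pen tau Ao + 2 * rdot (Ao - F) (Ao - F) + rdot (B - Ao) (B - Ao) <=
  R_pen tau B + 2 * rdot (B - F) (B - F).
Proof.
move=> BH; have := fixed_point_subgradient B.
have oBA : rdot (Wo - PH Wo) (B - Ao) = 0.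
  by apply: (orth_rdot (orth_projP H Wo).2); rewrite memvB // fixed_point_mem.
have -> : rdot Wo (B - Ao) = 2 * rdot F (B - Ao) - rdot Ao (B - Ao).
  have {1}-> : Wo = (Wo - PH Wo) + (of_real k 2 *: F - Ao).
    by rewrite rmorph_nat; apply/matrixP => i j; rewrite !mxE; ring.
  by rewrite rdotDl oBA rdotDl rdotZl rdotNl add0r.
move: (Ao) => A; rewrite !rdotE (rdotC A F) (rdotC B F) (rdotC B A); lra.
Qed.

End FixedPoints.

(** Quadratic growth away from [A] makes it the only minimiser. *)
Lemma argmin_unique (R : realType) (k : scalar_kind) (m n : nat)
    (S : set 'M[scalar_field R k]_(m, n)) (J : 'M[scalar_field R k]_(m, n) -> R)
    (A : 'M[scalar_field R k]_(m, n)) (c : R) :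
  0 < c -> S A -> (forall B, S B -> J A + c * rdot (B - A) (B - A) <= J B) ->
  argmin S J = [set A].
Proof.
move=> c0 SA gap; apply/seteqP; split=> [B [SB minB]|_ ->].
  apply/eqP; rewrite -subr_eq0; apply/eqP/rdot_eq0/le_anti; rewrite rdot_ge0 andbT.
  have := le_trans (gap B SB) (minB A SA).
  by rewrite gerDl pmulr_rle0.
split=> // B SB; apply: le_trans (gap B SB).
by rewrite lerDl mulr_ge0 ?rdot_ge0 // ltW.
Qed.

Theorem theorem1p1 (R : realType) (k : scalar_kind) (M N : nat)
    (H : {vspace 'M[scalar_field R k]_(M, N)}) (F : 'M[scalar_field R k]_(M, N)) (tau : R)
    (hF : F \in H) (htau : 0 < tau) :
  [/\ forall W1 : 'M[scalar_field R k]_(M, N),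
        exists2 Wo : 'M[scalar_field R k]_(M, N),
          B_op H F tau 2 Wo = Wo &
          (fun n : nat => frob_norm (iter n (B_op H F tau 2) W1 - Wo)) @ \oo
            --> (0 : R),
      forall Wo Wo' : 'M[scalar_field R k]_(M, N),
        B_op H F tau 2 Wo = Wo -> B_op H F tau 2 Wo' = Wo' ->
        orth_proj [set` H] Wo = orth_proj [set` H] Wo' &
      forall Wo : 'M[scalar_field R k]_(M, N),
        B_op H F tau 2 Wo = Wo ->
        let Ao : 'M[scalar_field R k]_(M, N) := 2 *: F - orth_proj [set` H] Wo in
        [/\ argmin [set` H]
              (fun A => R_pen tau A + 2 * frob_norm (A - F) ^+ 2) = [set Ao],
            argmin setT
              (fun A => R_pen tau A + frob_norm (A - Wo) ^+ 2) Ao &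
            (forall j : 'I_(minn M N), singular_values Wo j <> tau) ->
            let sigma0 : R := tau / Num.sqrt 2 in
            argmin [set` H]
              (fun A => sigma0 ^+ 2 * (\rank A)%:R + frob_norm (A - F) ^+ 2)
              = [set Ao]]].
Proof.
have convex_argmin Wo : B_op H F tau 2 Wo = Wo ->
    argmin [set` H] (fun A => R_pen tau A + 2 * frob_norm (A - F) ^+ 2) =
    [set 2 *: F - orth_proj [set` H] Wo].
  move=> fixWo; apply: (@argmin_unique _ _ _ _ _ _ _ 1) => // [|B BH].
    exact: fixed_point_mem.
  by rewrite !sqr_frob_norm mul1r; exact: fixed_point_gap.
split=> [W1|Wo Wo' fixWo fixWo'|Wo fixWo Ao].
- have [C bounded] := B_op_iter_bounded tau hF W1.
  have half_gt0 : 0 < 2^-1 :> R by rewrite invr_gt0.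
  exact: (picard_averaged half_gt0 (B_op_averaged H F tau) bounded).
- have := convex_argmin _ fixWo; rewrite (convex_argmin _ fixWo') => eqA.
  have : [set 2 *: F - orth_proj [set` H] Wo'] (2 *: F - orth_proj [set` H] Wo).
    by rewrite eqA.
  by move=> /addrI /oppr_inj.
split; first exact: convex_argmin.
- split=> // B _; rewrite !sqr_frob_norm.
  have := fixed_point_subgradient htau fixWo B.
  rewrite -/Ao; clearbody Ao.
  by rewrite !rdotE (rdotC Ao Wo) (rdotC B Wo); lra.
move=> neq_tau sigma0.
have sigma0E : sigma0 ^+ 2 = tau ^+ 2 / 2 by rewrite expr_div_n sqr_sqrtr.
(* The rank objective is half of a function that lies above the convex one on
   [H] and agrees with it at [Ao]; whence the growth constant. *)
apply: (@argmin_unique _ _ _ _ _ _ _ 2^-1) => [||B BH].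
- by rewrite invr_gt0.
- exact: fixed_point_mem.
have rank_Ao : R_pen tau Ao = tau ^+ 2 * (\rank Ao)%:R.
  have [U [y [V [svdY WoE AoE]]]] := fixed_point_svd fixWo.
  have svdW := svd_map (s_fun0 tau) (@s_fun_mono _ tau) svdY.
  have r0 : 0 - s_fun tau 2 0 = 0 by rewrite s_fun0 // subr0.
  have := svd_map r0 (@s_fun_residual_mono _ tau) svdY.
  rewrite -(svd_residual _ svdY) -WoE -AoE -/Ao => svdA.
  apply: (R_pen_eq_rank htau svdA) => j; apply: s_fun_neq_tau => //.
    by case: svdY => _ _ [].
  by have := neq_tau j; rewrite WoE (singular_valuesE svdW).
have := fixed_point_gap hF htau fixWo BH; have := R_pen_le_rank htau B.
rewrite -/Ao rank_Ao !sqr_frob_norm sigma0E; lra.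
Qed.
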